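(* Let $\beta>0$, $n\ge0$, and let $V\in C(\mathbb{R}^2)\cap C^1(\mathbb{R}^2\setminus\{0\})$ be a non-negative and radially decreasing function. Assume that $rV'(r)\in C([0,\infty))$, that $$\sup_{r\ge0}r^{n+2+\delta}V(r)<\infty$$ for some $\delta>0$, and that for every constant $0<c<n+2$ there exists $r_c>0$ satisfying $$cV(r)+rV'(r)\ge0,\quad r\le r_c,\qquad\qquad cV(r)+rV'(r)\le0,\quad r\ge r_c.$$ Then there exists at most one radially symmetric $\psi\in C^2(\mathbb{R}^2)$ such that $$-\Delta\psi(x)=4\pi\beta|x|^nV(x)e^{\psi(x)},\ x\in\mathbb{R}^2,\qquad\int_{\mathbb{R}^2}|x|^nV(x)e^{\psi(x)}\,dx=1.$$
   Context: A radially decreasing function is a radially symmetric function $V(x)=V(|x|)$ which is decreasing in $r=|x|$; $V'(r)$ is the derivative in $r$. *)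

(* Defs.v *)
From HB Require Import structures.
From mathcomp Require Import all_boot all_order all_algebra.
From mathcomp Require Import all_classical all_reals all_analysis.

Set Implicit Arguments.
Unset Strict Implicit.
Unset Printing Implicit Defensive.

Import Order.TTheory GRing.Theory Num.Theory.
Import numFieldNormedType.Exports.

Local Open Scope classical_set_scope.
Local Open Scope ring_scope.

Section Plane.
Variable R : realType.
Implicit Types (D : set (R * R)) (f V psi : R * R -> R) (p : R * R).

(* The library norm on R * R is the maximum norm; it induces the same topology
   as this one, but it is not the |x| of the equation. *)
Definition enorm p : R := Num.sqrt (p.1 ^+ 2 + p.2 ^+ 2).

Definition e1 : R * R := (1, 0).
Definition e2 : R * R := (0, 1).

(* C^k on an open set D. *)
Fixpoint classC (k : nat) D f : Prop :=
  (forall p, D p -> {for p, continuous f}) /\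
  if k is j.+1 then
    [/\ forall p, D p -> derivable f p e1 /\ derivable f p e2,
        classC j D ('D_e1 f) & classC j D ('D_e2 f)]
  else True.

Definition laplacian f p : R := 'D_e1 ('D_e1 f) p + 'D_e2 ('D_e2 f) p.

Definition radially_symmetric f : Prop :=
  forall p q, enorm p = enorm q -> f p = f q.

(* For a radially symmetric f and r >= 0 this is the value f(r) of f on the
   circle of radius r. *)
Definition profile f (r : R) : R := f (r, 0).

Definition radially_decreasing V : Prop :=
  radially_symmetric V /\
  forall r s, 0 <= r -> r <= s -> profile V s <= profile V r.

(* The factor r makes the value at r = 0 equal to 0, whatever the derivative of
   the (even) profile is there. *)
Definition rdprofile V (r : R) : R := r * derive1 (profile V) r.

(* powR satisfies 0 `^ 0 = 1, so |x|^n is the constant 1 for n = 0. *)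
Definition density (n : R) V psi p : R :=
  enorm p `^ n * V p * expR (psi p).

Definition liouville_solution (beta n : R) V psi : Prop :=
  (forall p, - laplacian psi p = 4 * pi * beta * density n V psi p) /\
  (\int[lebesgue_measure \x lebesgue_measure]_p (density n V psi p)%:E = 1)%E.

End Plane.

(* Main.v *)
Require Import Defs.
From HB Require Import structures.
From mathcomp Require Import all_boot all_order all_algebra.
From mathcomp Require Import all_classical all_reals all_analysis.
From mathcomp Require Import measurable_realfun.
From mathcomp Require Import ring lra.

Set Implicit Arguments.
Unset Strict Implicit.
Unset Printing Implicit Defensive.

Import Order.TTheory GRing.Theory Num.Theory.
Import numFieldNormedType.Exports.

Local Open Scope classical_set_scope.
Local Open Scope ring_scope.

(* Write p = r psi' for a radial solution psi and B = 4 pi beta; the equation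
   becomes p' = - B r^(n+1) V e^psi, and the mass condition fixes the limit of p
   at infinity.  If two solutions differ, they differ at 0 (Gronwall), say
   psi1(0) < psi2(0).  The difference d = psi2 - psi1 must vanish first at some t0,
   with q = p2 - p1 < 0 there.  For c = - (p1 + p2)(t0) / 2 > 0 the Pohozaev
   functional p^2/2 + c p + B r^(n+2) V e^psi has derivative
   B r^(n+1) e^psi H with H = (n+2-c) V + r V', so the difference D of the two
   functionals vanishes at 0 and, by the choice of c, at t0.  Hence H must change
   sign before t0, and H <= 0 afterwards.  Past t0 this makes D nondecreasing as
   long as q < 0, which contradicts D <= 0 at the next zero of q, or the limit
   D -> 0 at infinity if q has no further zero. *)

(** * One-variable calculus: derivative rules, consequences of the mean value theorem, first
    zeros *)

Section Calculus.
Context {R : realType}.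
Implicit Types (f g df : R -> R) (a b x : R).

Lemma is_derive_continuous f x d : is_derive x 1 f d -> {for x, continuous f}.
Proof.
by move=> fd; apply/differentiable_continuous/derivable1_diffP/ex_derive.
Qed.

Lemma derivable_for_continuous f x : derivable f x 1 -> {for x, continuous f}.
Proof. by move=> fd; apply/differentiable_continuous/derivable1_diffP. Qed.

Lemma is_deriveM_fun f g x d e : is_derive x 1 f d -> is_derive x 1 g e ->
  is_derive x 1 (fun y => f y * g y) (f x * e + g x * d).
Proof. by move=> fd ge; apply: (is_deriveM fd ge). Qed.

Lemma is_deriveD_fun f g x d e : is_derive x 1 f d -> is_derive x 1 g e ->
  is_derive x 1 (fun y => f y + g y) (d + e).
Proof. by move=> fd ge; apply: (is_deriveD fd ge). Qed.

Lemma is_deriveB_fun f g x d e : is_derive x 1 f d -> is_derive x 1 g e ->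
  is_derive x 1 (fun y => f y - g y) (d - e).
Proof. by move=> fd ge; apply: (is_deriveB fd ge). Qed.

Lemma is_deriveZ_fun f x d a : is_derive x 1 f d ->
  is_derive x 1 (fun y => a * f y) (a * d).
Proof. by move=> fd; apply: (is_deriveZ a fd). Qed.

Lemma is_derive_expR_comp f x d : is_derive x 1 f d ->
  is_derive x 1 (fun y => expR (f y)) (expR (f x) * d).
Proof. by move=> fd; apply: (@is_derive1_comp _ expR f). Qed.

Lemma continuous_within_itvcc f a b :
  (forall x, a <= x <= b -> {for x, continuous f}) ->
  {within `[a, b], continuous f}.
Proof.
move=> fc; apply: continuous_in_subspaceT => x.
by rewrite inE /= in_itv /=; exact: fc.
Qed.

Lemma mean_value f df a b : a <= b ->
  (forall x, a < x < b -> is_derive x 1 f (df x)) ->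
  (forall x, a <= x <= b -> {for x, continuous f}) ->
  exists2 c, a <= c <= b /\ (a < b -> a < c < b) & f b - f a = df c * (b - a).
Proof.
rewrite le_eqVlt => /predU1P[<- _ _|ab fd fc].
  by exists a; rewrite ?ltxx ?lexx// !subrr mulr0.
have fd' x : x \in `]a, b[ -> is_derive x 1 f (df x).
  by rewrite in_itv; exact: fd.
have [c] := MVT ab fd' (continuous_within_itvcc fc).
rewrite in_itv /= => /andP[ac cb] fE; exists c => //.
by rewrite !ltW// ac cb.
Qed.

Lemma derive_ge0_le f df a b : a <= b ->
  (forall x, a < x < b -> is_derive x 1 f (df x)) ->
  (forall x, a <= x <= b -> {for x, continuous f}) ->
  (forall x, a < x < b -> 0 <= df x) -> f a <= f b.
Proof.
rewrite le_eqVlt => /predU1P[<- //|ab fd fc d0].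
have [c [_ /(_ ab) cab] fE] := mean_value (ltW ab) fd fc.
by rewrite -subr_ge0 fE mulr_ge0 ?d0// subr_ge0 ltW.
Qed.

Lemma derive_le0_ge f df a b : a <= b ->
  (forall x, a < x < b -> is_derive x 1 f (df x)) ->
  (forall x, a <= x <= b -> {for x, continuous f}) ->
  (forall x, a < x < b -> df x <= 0) -> f b <= f a.
Proof.
rewrite le_eqVlt => /predU1P[<- //|ab fd fc d0].
have [c [_ /(_ ab) cab] fE] := mean_value (ltW ab) fd fc.
by rewrite -subr_le0 fE mulr_le0_ge0 ?d0// subr_ge0 ltW.
Qed.

Lemma derive_lt0_gt f df a b : a < b ->
  (forall x, a < x < b -> is_derive x 1 f (df x)) ->
  (forall x, a <= x <= b -> {for x, continuous f}) ->
  (forall x, a < x < b -> df x < 0) -> f b < f a.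
Proof.
move=> ab fd fc d0.
have [c [_ /(_ ab) cab] fE] := mean_value (ltW ab) fd fc.
by rewrite -subr_lt0 fE nmulr_rlt0 ?d0// subr_gt0.
Qed.

Lemma derive_eq0_cst f df a b : a <= b ->
  (forall x, a < x < b -> is_derive x 1 f (df x)) ->
  (forall x, a <= x <= b -> {for x, continuous f}) ->
  (forall x, a < x < b -> df x = 0) -> f a = f b.
Proof.
move=> ab fd fc d0; apply/eqP; rewrite eq_le.
rewrite (derive_ge0_le ab fd fc) ?(derive_le0_ge ab fd fc)//.
  by move=> x /d0 ->.
by move=> x /d0 ->.
Qed.

Lemma derive_norm_le f df a b k : a <= b ->
  (forall x, a < x < b -> is_derive x 1 f (df x)) ->
  (forall x, a <= x <= b -> {for x, continuous f}) ->
  (forall x, a < x < b -> `|df x| <= k) -> `|f b - f a| <= k * (b - a).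
Proof.
rewrite le_eqVlt => /predU1P[<- *|ab fd fc d0]; first by rewrite !subrr mulr0 normr0.
have [c [_ /(_ ab) cab] ->] := mean_value (ltW ab) fd fc.
by rewrite normrM (ger0_norm (_ : 0 <= b - a)) ?ler_wpM2r ?d0// subr_ge0 ltW.
Qed.

Lemma near_gt0 f x : {for x, continuous f} -> 0 < f x ->
  exists2 e, 0 < e & forall y, `|x - y| < e -> 0 < f y.
Proof.
move=> fc f0.
have : \forall y \near x, 0 < f y by exact: (cvgr_gt _ fc).
by move=> /nbhs_ballP[e /= e0 He]; exists e.
Qed.

(** The zero is the infimum of the points of $[a,\infty)$ where [f] is nonpositive. By continuity a
    positive value there would contradict the points of the set nearby, and a negative value the
    points to its left. *)
Lemma first_zero f a b : continuous f -> a <= b -> 0 < f a -> f b <= 0 ->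
  exists t, [/\ a < t, f t = 0 & forall s, a <= s -> s < t -> 0 < f s].
Proof.
move=> fc ab fa fb.
pose Z := [set t | a <= t /\ f t <= 0].
have Zb : Z b by [].
have Zlb : lbound Z a by move=> t [].
have Zinf : has_inf Z by split; [exists b|exists a].
have at_ : a <= inf Z by apply: lb_le_inf => //; exists b.
have pos s : a <= s -> s < inf Z -> 0 < f s.
  move=> as_ sZ; rewrite ltNge; apply/negP => fs.
  by move: sZ; rewrite ltNge (ge_inf (proj2 Zinf)).
have fle : f (inf Z) <= 0.
  rewrite leNgt; apply/negP => /(near_gt0 (@fc _)) [e e0 He].
  have [z Zz ze] := inf_adherent e0 Zinf.
  have Iz : inf Z <= z by apply: ge_inf => //; exact: (proj2 Zinf).
  have := He z; rewrite distrC ger0_norm ?subr_ge0// ltrBlDl => /(_ ze).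
  by rewrite ltNge (proj2 Zz).
have at0 : a < inf Z.
  rewrite lt_neqAle at_ andbT; apply/eqP => aE.
  by move: fa; rewrite aE ltNge fle.
exists (inf Z); split => //; apply/eqP; rewrite eq_le fle /= leNgt.
apply/negP => f0.
have [||e e0 He] := @near_gt0 (fun x => - f x) (inf Z).
- by apply: continuousN; exact: fc.
- by rewrite oppr_gt0.
pose s := Num.max a (inf Z - e / 2).
have sI : s < inf Z by rewrite gt_max at0 /= ltrBlDr ltrDl divr_gt0.
have := He s; rewrite ger0_norm ?subr_ge0 ?(ltW sI)// oppr_gt0.
have se : inf Z - e / 2 <= s by rewrite le_max lexx orbT.
have fs : 0 < f s by rewrite pos// le_max lexx.
by move=> fsN; have := fsN ltac:(lra); lra.
Qed.

Lemma cvg_cstM {T : Type} (F : set_system T) {FF : Filter F} (h : T -> R) (k l : R) :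
  h x @[x --> F] --> l -> k * h x @[x --> F] --> k * l.
Proof. by move=> hl; apply: cvgM => //; exact: cvg_cst. Qed.

Lemma cvg_Mcst {T : Type} (F : set_system T) {FF : Filter F} (h : T -> R) (k l : R) :
  h x @[x --> F] --> l -> h x * k @[x --> F] --> l * k.
Proof. by move=> hl; apply: cvgM => //; exact: cvg_cst. Qed.

(** An error bound without division, the form in which integrals over thin annuli are estimated
    later. *)
Lemma is_derive_of_bound (f : R -> R) (x l : R) :
  (forall e, 0 < e -> \forall y \near x, `|f y - f x - l * (y - x)| <= e * `|y - x|) ->
  is_derive x 1 f l.
Proof.
move=> H.
have cf : (fun h => h^-1 *: ((f \o shift x) (h *: 1) - f x)) @ 0^' --> l.
  apply/cvgrPdist_le => e e0; near=> h.
  have hn0 : h != 0 by near: h; exact: nbhs_dnbhs_neq.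
  have Hh : `|f (h + x) - f x - l * (h + x - x)| <= e * `|h + x - x|.
    near: h; apply: cvg_within; move: (H e e0) => /nbhs0P.
    by apply: filterS => h; rewrite [x + h]addrC.
  rewrite addrK in Hh; rewrite /= [h *: 1]mulr1.
  have -> : l - h^-1 *: (f (h + x) - f x) = - (h^-1 * (f (h + x) - f x - l * h)).
    by rewrite /GRing.scale /=; field.
  by rewrite normrN normrM normfV ler_pdivrMl ?normr_gt0// [leRHS]mulrC.
by apply: DeriveDef; [apply/cvg_ex; exists l|apply/cvg_lim].
Unshelve. all: by end_near. Qed.

End Calculus.

(** With $y \le x$, factor out $e^x$ and use $e^t \ge 1 + t$ at $t = y - x$. *)
Lemma expR_sub_le {R : realType} (x y M : R) : x <= M -> y <= M ->
  `|expR x - expR y| <= expR M * `|x - y|.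
Proof.
wlog yx : x y / y <= x => [wlg xM yM|xM yM].
  have [/wlg -> //|/ltW /wlg xy] := leP y x.
  by rewrite distrC [X in _ * X]distrC; exact: xy.
rewrite !ger0_norm ?subr_ge0 ?ler_expR//.
rewrite (@le_trans _ _ (expR x * (x - y)))//; last first.
  by rewrite ler_wpM2r ?subr_ge0// ler_expR.
have -> : expR y = expR x * expR (y - x) by rewrite -expRD addrC subrK.
rewrite -[X in X - _]mulr1 -mulrBr ler_wpM2l ?expR_ge0//.
by have := expR_ge1Dx (y - x); lra.
Qed.

Lemma powRD1 {R : realType} (a x : R) : 0 < x -> x `^ (a + 1) = x `^ a * x.
Proof.
by move=> x0; rewrite powRD ?powRr1 ?ltW//; apply/implyP => _; rewrite gt_eqF.
Qed.

(** * The radial equation as a system for [g] and [flux g]; uniqueness for a given value at 0 *)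

Section RadialODE.
Context {R : realType} (B n : R) (V : R -> R).
Context (B_gt0 : 0 < B) (n_ge0 : 0 <= n).
Context (V_ge0 : forall r : R, 0 <= r -> 0 <= V r)
  (V_noninc : forall r s : R, 0 <= r -> r <= s -> V s <= V r).
Implicit Types (g : R -> R) (r : R).

(** For [g] the profile of a radial function, $2\pi$ times this is the flux of the gradient through
    the circle of radius $r$. *)
Definition flux g r : R := r * derive1 g r.

(* For g the profile of psi this is the equation
   - Delta psi = B |x|^n V e^psi multiplied by r. *)
Definition radial_solution g :=
  [/\ forall r, derivable g r 1, continuous (derive1 g)
    & forall r, 0 < r ->
        is_derive r 1 (flux g) (- (B * r `^ (n + 1) * V r * expR (g r)))].

Lemma solution_continuous g : radial_solution g -> continuous g.
Proof. by move=> [dg _ _] r; exact: derivable_for_continuous. Qed.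

Lemma flux_continuous g : radial_solution g -> continuous (flux g).
Proof. by move=> [_ cg _] r; apply: continuousM => //; exact: cg. Qed.

Lemma solution_is_derive g r : radial_solution g -> r != 0 ->
  is_derive r 1 g (flux g r / r).
Proof.
move=> [dg _ _] r0; rewrite /flux mulrAC divff// mul1r derive1E.
exact: derivableP.
Qed.

Lemma weight_ge0 r : 0 <= r -> 0 <= B * r `^ (n + 1) * V r.
Proof. by move=> r0; rewrite !mulr_ge0 ?powR_ge0 ?V_ge0// ltW. Qed.

Lemma flux0 g : flux g 0 = 0. Proof. by rewrite /flux mul0r. Qed.

Lemma flux_nonincreasing g r s : radial_solution g -> 0 <= r -> r <= s ->
  flux g s <= flux g r.
Proof.
move=> sg r0 rs; have [_ _ dg] := sg.
have dg' x : r < x < s ->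
    is_derive x 1 (flux g) (- (B * x `^ (n + 1) * V x * expR (g x))).
  by move=> /andP[/(le_lt_trans r0) x0 _]; exact: dg.
apply: (derive_le0_ge rs dg') => x; first by move=> _; exact: flux_continuous.
move=> /andP[/ltW/(le_trans r0) x0 _].
by rewrite oppr_le0 mulr_ge0 ?expR_ge0 ?weight_ge0.
Qed.

Lemma flux_le0 g r : radial_solution g -> 0 <= r -> flux g r <= 0.
Proof. by move=> sg r0; rewrite -(flux0 g) flux_nonincreasing. Qed.

(** The derivative [flux g r / r] is nonpositive. This bounds $e^g$ on the half-line, which supplies
    the Lipschitz constant below and the control of the exponentials at infinity. *)
Lemma solution_le0 g r : radial_solution g -> 0 <= r -> g r <= g 0.
Proof.
move=> sg r0.
have dg x : 0 < x < r -> is_derive x 1 g (flux g x / x).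
  by move=> /andP[x0 _]; apply: solution_is_derive; rewrite ?gt_eqF.
apply: (derive_le0_ge r0 dg) => x; first by move=> _; exact: solution_continuous.
by move=> /andP[x0 _]; rewrite mulr_le0_ge0 ?invr_ge0 ?flux_le0 ?ltW.
Qed.

Section Local.
Context (g1 g2 : R -> R) (sol1 : radial_solution g1) (sol2 : radial_solution g2).
Context (g12 : g1 0 = g2 0).

(* The step size h depends only on T, so finitely many steps reach T although
   the equation is singular at 0. *)
Lemma local_uniqueness (T h S : R) : 0 < h ->
  B * T `^ n * V 0 * expR (g1 0) * (h * h) <= 1 / 2 ->
  0 <= S -> S + h <= T -> g2 S = g1 S -> flux g2 S = flux g1 S ->
  forall r, S <= r <= S + h -> g2 r = g1 r /\ flux g2 r = flux g1 r.
Proof.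
set L := B * _ * _ * _ => h0 Lh S0 ShT dS qS.
have L0 : 0 <= L by rewrite !mulr_ge0 ?powR_ge0 ?expR_ge0 ?V_ge0// ltW.
pose d r := g2 r - g1 r; pose q r := flux g2 r - flux g1 r.
have dc : continuous d.
  by move=> x; apply: continuousB; apply: solution_continuous.
have qc : continuous q.
  by move=> x; apply: continuousB; apply: flux_continuous.
(* Contraction in the supremum norm: with [m] the maximum of $|d|$ over the step, [qle] and [dle]
   give $m \le m/2$, so $m = 0$. *)
have [c ccS cmax] : exists2 c, c \in `[S, S + h] &
    forall t, t \in `[S, S + h] -> `|d t| <= `|d c|.
  apply: EVT_max; first by rewrite lerDl ltW.
  apply: continuous_subspaceT => x.
  by apply: cvg_norm; exact: dc.
move: ccS; rewrite in_itv /= => cS.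
have [m mE] : exists m : R, m = `|d c| by exists `|d c|.
rewrite -mE in cmax.
have m0 : 0 <= m by rewrite mE.
have dm t : S <= t <= S + h -> `|d t| <= m by move=> tS; rewrite cmax ?in_itv.
have qle r : S <= r <= S + h -> `|q r| <= L * r * m * (r - S).
  move=> /andP[Sr rS].
  have -> : q r = q r - q S by rewrite /q qS subrr subr0.
  pose dq x := - (B * x `^ (n + 1) * V x * expR (g2 x)) -
               - (B * x `^ (n + 1) * V x * expR (g1 x)).
  apply: (@derive_norm_le _ q dq) => //.
    move=> x /andP[Sx _]; have x0 : 0 < x by exact: le_lt_trans Sx.
    by apply: is_deriveB_fun; [case: sol2 => _ _|case: sol1 => _ _]; exact.
  - by move=> x _; exact: qc.
  move=> x /andP[Sx xr]; have x0 : 0 < x by exact: le_lt_trans Sx.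
  rewrite /dq opprK addrC -mulrBr normrM ger0_norm ?weight_ge0 ?(ltW x0)//.
  have eg : `|expR (g1 x) - expR (g2 x)| <= expR (g1 0) * m.
    apply: le_trans (expR_sub_le (solution_le0 sol1 (ltW x0)) _) _.
      by rewrite g12; exact: solution_le0 sol2 (ltW x0).
    by rewrite ler_wpM2l ?expR_ge0// distrC dm// (ltW Sx)/= (le_trans (ltW xr)).
  have xT : x <= T by rewrite (le_trans (ltW xr))// (le_trans rS).
  (* One factor [r] is kept apart from $T^n$; it cancels the singular $1/r$ of $d' = q/r$ in
     [dle]. *)
  have xn : x `^ (n + 1) <= T `^ n * r.
    rewrite (powRD1 _ x0) ler_pM ?powR_ge0 ?(ltW x0) ?(ltW xr)//.
    by rewrite ge0_ler_powR// nnegrE ?(ltW x0)// (le_trans (ltW x0)).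
  have VxV0 : V x <= V 0 by exact: V_noninc (ltW x0).
  apply: (@le_trans _ _ (B * (T `^ n * r) * V 0 * (expR (g1 0) * m))).
    apply: ler_pM => //; first by rewrite weight_ge0 ?ltW.
    apply: ler_pM; rewrite ?V_ge0 ?(ltW x0)//.
      by rewrite mulr_ge0 ?powR_ge0 ?ltW.
    by rewrite ler_wpM2l// ltW.
  rewrite le_eqVlt; apply/orP; left; apply/eqP; rewrite /L. ring.
clearbody L.
have dle r : S <= r <= S + h -> `|d r| <= m / 2.
  move=> /andP[Sr rS].
  have -> : d r = d r - d S by rewrite /d dS subrr subr0.
  pose dd x := flux g2 x / x - flux g1 x / x.
  apply: (@le_trans _ _ (L * m * h * (r - S))).
    apply: (@derive_norm_le _ d dd) => //.
      move=> x /andP[Sx _]; have x0 : x != 0 by rewrite gt_eqF// (le_lt_trans _ Sx).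
      by apply: is_deriveB_fun; exact: solution_is_derive.
    - by move=> x _; exact: dc.
    move=> x /andP[Sx xr]; have x0 : 0 < x by exact: le_lt_trans Sx.
    rewrite /dd -mulrBl normrM normfV (ger0_norm (ltW x0)) ler_pdivrMr//.
    have xSh : S <= x <= S + h by rewrite (ltW Sx)/= (le_trans (ltW xr)).
    apply: le_trans (qle x xSh) _.
    have -> : L * m * h * x = L * x * m * h by ring.
    have xSh' : x - S <= h by case/andP: xSh => _; lra.
    by rewrite ler_wpM2l// !mulr_ge0// ltW.
  apply: (@le_trans _ _ (L * m * h * h)).
    by rewrite ler_wpM2l; [|rewrite !mulr_ge0 ?(ltW h0)|lra].
  have -> : L * m * h * h = L * (h * h) * m by ring.
  by rewrite (le_trans (ler_wpM2r m0 Lh))//; lra.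
have {}m0 : m = 0 by have := dle _ cS; rewrite -mE; lra.
move=> r rS; split; apply/eqP; rewrite -subr_eq0 -normr_le0.
  by have := dm _ rS; rewrite m0.
by have := qle _ rS; rewrite m0 mulr0 mul0r.
Qed.

(** Steps of fixed length carry the equality of both profile and flux from 0 to [r]. The last step
    may pass [r] by at most $h \le 1$, hence $T = r + 1$. *)
Lemma solution_unique r : 0 <= r -> g1 r = g2 r.
Proof.
move=> r0; pose T := r + 1; pose L := B * T `^ n * V 0 * expR (g1 0).
have L0 : 0 <= L by rewrite !mulr_ge0 ?powR_ge0 ?expR_ge0 ?V_ge0// ltW.
(* This choice gives both $h \le 1$ and $L h \le 1/2$, hence $L h^2 \le 1/2$. *)
pose h : R := (1 + 2 * L)^-1.
have h0 : 0 < h by rewrite invr_gt0; lra.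
have h1 : h <= 1 by rewrite invf_le1; lra.
have Lh : L * (h * h) <= 1 / 2.
  have hE : h * (1 + 2 * L) = 1 by rewrite mulVf// gt_eqF//; lra.
  have : L * h <= 1 / 2 by lra.
  by rewrite mulrA => Lh2; rewrite (le_trans (ler_piMr _ h1))// mulr_ge0 // ltW.
have step k : k%:R * h <= r + h ->
    g2 (k%:R * h) = g1 (k%:R * h) /\ flux g2 (k%:R * h) = flux g1 (k%:R * h).
  elim: k => [_|k IH kr]; first by rewrite mul0r g12 !flux0.
  have kh : k.+1%:R * h = k%:R * h + h by rewrite -natr1 mulrDl mul1r.
  have [|dk qk] := IH; first by rewrite kh in kr; lra.
  apply: (@local_uniqueness T h (k%:R * h)) => //.
  - by rewrite mulr_ge0 // ltW.
  - by rewrite -kh (le_trans kr)// lerD2l.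
  - by rewrite kh lexx lerDl ltW.
pose k := Num.truncn (r / h).
have /andP[kr rk] : k%:R <= r / h < k.+1%:R by apply: truncn_itv; rewrite divr_ge0// ltW.
rewrite ler_pdivlMr// in kr; rewrite ltr_pdivrMr// in rk.
have [|dk qk] := step k; first by lra.
have krh : k%:R * h <= r <= k%:R * h + h.
  by rewrite kr/= ltW//; move: rk; rewrite -natr1 mulrDl mul1r.
have kh0 : 0 <= k%:R * h by rewrite mulr_ge0 // ltW.
have khT : k%:R * h + h <= T by rewrite /T; lra.
by have [-> _] := @local_uniqueness T h _ h0 Lh kh0 khT dk qk r krh.
Qed.
End Local.

End RadialODE.

(** * Contradiction from two solutions with [g1 0 < g2 0] and the same nonzero flux limit *)

Section Crossing.
Context {R : realType} (B n : R) (V : R -> R).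
Implicit Types r s t x y : R.
Context (B_gt0 : 0 < B) (n_ge0 : 0 <= n).
Context (V_ge0 : forall r : R, 0 <= r -> 0 <= V r)
  (V_noninc : forall r s : R, 0 <= r -> r <= s -> V s <= V r)
  (V_der : forall r : R, 0 < r -> derivable V r 1).
Context (V_decay : exists2 delta : R, 0 < delta &
    exists M : R, forall r : R, 0 <= r -> r `^ (n + 2 + delta) * V r <= M).
Context (V_sign : forall c : R, 0 < c -> c < n + 2 -> exists2 rc : R, 0 < rc &
  (forall r : R, 0 <= r -> r <= rc -> 0 <= c * V r + r * derive1 V r) /\
  (forall r : R, rc <= r -> c * V r + r * derive1 V r <= 0)).

Lemma profile_is_derive r : 0 < r -> is_derive r 1 V (derive1 V r).
Proof. by move=> /V_der dV; rewrite derive1E; exact: derivableP. Qed.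

Lemma profile_derive_le0 r : 0 < r -> derive1 V r <= 0.
Proof.
move=> r0; rewrite leNgt; apply/negP => D0.
(* Subtracting $kx$ makes [V] strictly decreasing, as [decr_derive1_le0_itvy] requires; half the
   slope leaves [f] a positive derivative at [r]. *)
pose k : R := derive1 V r / 2; have k0 : 0 < k by rewrite divr_gt0.
pose f x := V x - k * x.
have df (x : R) : 0 < x -> is_derive x 1 f (derive1 V x - k).
  move=> x0; apply: is_derive_eq.
    exact: is_deriveB_fun (profile_is_derive x0) (is_deriveZ_fun k (is_derive_id x 1)).
  by rewrite mulr1.
have : derive1 f r <= 0.
  apply: (@decr_derive1_le0_itvy _ f true 0 r).
  - by move=> x; rewrite inE /= in_itv /= andbT => /df dx; exact: ex_derive.
  - move=> x y xI yI xy; move: xI yI; rewrite !in_itv /= !andbT => x0 y0.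
    rewrite /f (le_lt_trans (lerD (V_noninc y0 (ltW xy)) (lexx _)))//.
    by rewrite ltrD2l ltrN2 ltr_pM2l.
  - by rewrite in_itv /= andbT.
by have := df r r0; move=> dr; rewrite derive1E derive_val /k; lra.
Qed.

(** Links the sign hypothesis to the monotonicity of $r^a V$ through the factor $aV + rV'$. *)
Lemma power_profile_is_derive (a x : R) : 0 < x ->
  is_derive x 1 (fun y => y `^ a * V y)
    (x `^ (a - 1) * (a * V x + x * derive1 V x)).
Proof.
move=> x0; apply: is_derive_eq.
  exact: is_deriveM_fun (is_derive1_powR a x0) (profile_is_derive x0).
have -> : x `^ a = x `^ (a - 1) * x by rewrite -powRD1// subrK.
by ring.
Qed.

(** Serves to exclude the equality cases: a constant positive $r^a V$ is incompatible with its limit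
    0 at the origin or at infinity. *)
Lemma power_profile_cst (a s t : R) : 0 < s -> s <= t ->
  (forall x, s < x < t -> a * V x + x * derive1 V x = 0) ->
  s `^ a * V s = t `^ a * V t.
Proof.
move=> s0 st H.
pose f y := y `^ a * V y; pose df x := x `^ (a - 1) * (a * V x + x * derive1 V x).
have fd x : s <= x -> is_derive x 1 f (df x).
  by move=> sx; apply: power_profile_is_derive; exact: lt_le_trans sx.
apply: (@derive_eq0_cst _ f df s t st).
- by move=> x /andP[/ltW/fd].
- by move=> x /andP[/fd /is_derive_continuous].
- by move=> x /H fx; rewrite /df fx mulr0.
Qed.

Lemma power_profile_cvg0_right (a : R) : 0 < a ->
  r `^ a * V r @[r --> 0^'+] --> 0.
Proof.
move=> a0; apply: (@squeeze_cvgr _ _ _ _ (fun=> 0) (fun r => r `^ a * V 0)).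
- near=> r; have r0 : 0 < r by near: r; exact: nbhs_right_gt.
  rewrite mulr_ge0 ?powR_ge0 ?V_ge0 ?(ltW r0)//=.
  by rewrite ler_wpM2l ?powR_ge0// V_noninc// ltW.
- exact: cvg_cst.
- rewrite -[X in _ --> X](mul0r (V 0)).
  by apply: cvg_Mcst; exact: powR_cvg0.
Unshelve. all: by end_near. Qed.

Lemma power_profile_cvg0_pinfty (a : R) : a <= n + 2 ->
  r `^ a * V r @[r --> +oo] --> 0.
Proof.
move=> an; have [delta delta0 [M HM]] := V_decay.
apply/cvgrPdist_le => e e0.
(* [K] solves $K^\delta = (|M| + 1)/e$: past it the spare factor $r^\delta$ of the decay hypothesis
   absorbs $M/e$. The added 1 keeps the base positive. *)
pose K := ((`|M| + 1) / e) `^ delta^-1.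
near=> r.
have r1 : 1 <= r by near: r; exact: nbhs_pinfty_ge.
have rK : K <= r by near: r; apply: nbhs_pinfty_ge; exact: num_real.
have r0 : 0 < r by exact: lt_le_trans r1.
rewrite sub0r normrN ger0_norm ?mulr_ge0 ?powR_ge0 ?V_ge0 ?(ltW r0)//.
have M1 : 0 < `|M| + 1 by rewrite ltr_wpDl.
have rd : (`|M| + 1) / e <= r `^ delta.
  have -> : (`|M| + 1) / e = K `^ delta.
    by rewrite /K -powRrM mulVf ?gt_eqF// powRr1// divr_ge0// ltW.
  by rewrite ge0_ler_powR ?nnegrE ?powR_ge0 ?(ltW r0) ?(ltW delta0).
rewrite (@le_trans _ _ (r `^ (n + 2) * V r))//.
  by rewrite ler_wpM2r ?V_ge0 ?(ltW r0)// ler_powR.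
have rd0 : 0 < r `^ delta by rewrite powR_gt0.
rewrite -(ler_pM2l rd0) mulrA.
have -> : r `^ delta * r `^ (n + 2) = r `^ (n + 2 + delta).
  by rewrite mulrC -powRD//; apply/implyP => _; rewrite gt_eqF.
apply: (le_trans (HM r (ltW r0))).
rewrite -ler_pdivrMr//; apply: le_trans rd.
by rewrite ler_pM2r ?invr_gt0//; have := ler_norm M; lra.
Unshelve. all: by end_near. Qed.

Context (g1 g2 : R -> R) (m : R).
Context (sol1 : radial_solution B n V g1) (sol2 : radial_solution B n V g2).
Context (lim1 : flux g1 r @[r --> +oo] --> m) (lim2 : flux g2 r @[r --> +oo] --> m).
Context (m_neq0 : m != 0) (g12 : g1 0 < g2 0).

Let d r := g2 r - g1 r.
Let q r := flux g2 r - flux g1 r.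
Let dq r := B * r `^ (n + 1) * V r * (expR (g1 r) - expR (g2 r)).

Let d_continuous : continuous d.
Proof. move=> x; apply: continuousB.
  exact: solution_continuous sol2 x.
exact: solution_continuous sol1 x. Qed.

Let q_continuous : continuous q.
Proof. move=> x; apply: continuousB.
  exact: flux_continuous sol2 x.
exact: flux_continuous sol1 x. Qed.

Let d_is_derive r : 0 < r -> is_derive r 1 d (q r / r).
Proof.
move=> r0; rewrite /q mulrBl.
have rn0 : r != 0 by rewrite gt_eqF.
apply: is_deriveB_fun (solution_is_derive sol2 rn0) (solution_is_derive sol1 rn0).
Qed.

Let q_is_derive r : 0 < r -> is_derive r 1 q (dq r).
Proof.
case: sol1 => _ _ d1; case: sol2 => _ _ d2 r0; apply: is_derive_eq.
  exact: is_deriveB_fun (d2 r r0) (d1 r r0).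
by rewrite /dq; ring.
Qed.

Let q_cvg0 : q r @[r --> +oo] --> 0.
Proof. by rewrite -(subrr m); exact: cvgB. Qed.

(** If [V] vanished on $(0,\infty)$, [flux g1] would keep its value 0 at the origin, against the
    limit $m \ne 0$. *)
Let profile_pos_somewhere : exists2 r, 0 < r & 0 < V r.
Proof.
apply: contrapT => noV; move: m_neq0 => /eqP; apply.
have V0 r : 0 < r -> V r = 0.
  move=> r0; apply/eqP; rewrite eq_le V_ge0 ?(ltW r0)// andbT leNgt.
  by apply/negP => Vr; apply: noV; exists r.
case: sol1 => _ _ d1; apply: (cvg_unique _ lim1) => //.
apply: cvg_near_cst; near=> r.
have r0 : 0 < r by near: r; exact: nbhs_pinfty_gt.
rewrite -(flux0 g1); apply/esym.
apply: (derive_eq0_cst (ltW r0) (fun x (x0r : 0 < x < r) => d1 x (proj1 (andP x0r)))).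
- by move=> x _; exact: flux_continuous sol1 x.
- by move=> x /andP[x0 _]; rewrite V0// mulr0 mul0r oppr0.
Unshelve. all: by end_near. Qed.

Let q_lt0 t : 0 < t -> (forall s, 0 < s < t -> 0 < d s) -> q t < 0.
Proof.
move=> t0 dpos; have [r0 r00 Vr0] := profile_pos_somewhere.
(* Strictness comes from $(0,s)$, where [V] is at least [V r0] and thus positive; on $[s,t]$ it is
   enough that [q] does not increase. *)
pose s := Num.min t r0.
have s0 : 0 < s by rewrite lt_min t0 r00.
have st : s <= t by rewrite ge_min lexx.
have sr : s <= r0 by rewrite ge_min lexx orbT.
have eg x : 0 < x < t -> expR (g1 x) - expR (g2 x) < 0.
  by move=> /dpos; rewrite subr_gt0 subr_lt0 ltr_expR.
apply: (@le_lt_trans _ _ (q s)).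
  apply: (@derive_le0_ge _ q dq s t st) => [x /andP[sx _]|x _|x /andP[sx xt]].
  - by apply: q_is_derive; exact: lt_trans sx.
  - exact: q_continuous.
  - have x0 : 0 < x by exact: lt_trans sx.
    by rewrite mulr_ge0_le0 ?weight_ge0 ?(ltW x0)// ltW// eg// x0.
have -> : 0 = q 0 by rewrite /q !flux0 subrr.
apply: (@derive_lt0_gt _ q dq 0 s s0) => [x /andP[x0 _]|x _|x /andP[x0 xs]].
- exact: q_is_derive.
- exact: q_continuous.
- rewrite pmulr_rlt0 ?eg ?x0 ?(lt_le_trans xs)//.
  rewrite !mulr_gt0 ?powR_gt0// (lt_le_trans Vr0)// V_noninc// ltW//.
  exact: lt_le_trans sr.
Qed.

(** If [d] stayed positive, [q] would be nonincreasing and negative at 1, so it could not tend to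
    0. *)
Let d_crosses : exists t, [/\ 0 < t, d t = 0 & forall s, 0 <= s -> s < t -> 0 < d s].
Proof.
have [[b b0 db]|nob] := pselect (exists2 b, 0 <= b & d b <= 0).
  by apply: (first_zero d_continuous b0 _ db); rewrite subr_gt0.
exfalso.
have dpos s : 0 <= s -> 0 < d s.
  by move=> s0; rewrite ltNge; apply/negP => ds; apply: nob; exists s.
have q1 : q 1 < 0 by apply: q_lt0 => // s /andP[/ltW/dpos].
suff : 0 <= q 1 by lra.
apply: (cvgr_to_le q_cvg0); near=> r.
have r1 : 1 <= r by near: r; exact: nbhs_pinfty_ge.
apply: (@derive_le0_ge _ q dq 1 r r1) => [x /andP[sx _]|x _|x /andP[x1 _]].
- by apply: q_is_derive; exact: lt_trans sx.
- exact: q_continuous.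
- have x0 : 0 < x by exact: lt_trans x1.
  rewrite mulr_ge0_le0 ?weight_ge0 ?(ltW x0)// subr_le0 ler_expR.
  by have := dpos x (ltW x0); rewrite /d; lra.
Unshelve. all: by end_near. Qed.

Let q_eventually_nonneg (s : R) : (forall r, s <= r -> q r <= q s) -> 0 <= q s.
Proof.
move=> qs; apply: (cvgr_to_le q_cvg0); near=> r; apply: qs.
by near: r; apply: nbhs_pinfty_ge; exact: num_real.
Unshelve. all: by end_near. Qed.

(** * The Pohozaev functional before and after the first crossing [t0] *)

Section Energy.
Context (t0 : R) (t0_gt0 : 0 < t0) (dt0 : d t0 = 0)
  (d_pos : forall s, 0 <= s -> s < t0 -> 0 < d s).

Let c : R := - (flux g1 t0 + flux g2 t0) / 2.

Let qt0 : q t0 < 0.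
Proof. by apply: q_lt0 => // s /andP[/ltW]; exact: d_pos. Qed.

(** Neither flux is positive, and [q t0 < 0] makes that of [g2] strictly negative at [t0]. *)
Let c_gt0 : 0 < c.
Proof.
have := flux_le0 B_gt0 V_ge0 sol1 (ltW t0_gt0).
have := flux_le0 B_gt0 V_ge0 sol2 (ltW t0_gt0).
by move: qt0; rewrite /c /q; lra.
Qed.

(** Otherwise [V] vanishes past [t0] by monotonicity, and [q] stays at a negative value instead of
    tending to 0. *)
Let V_t0 : 0 < V t0.
Proof.
rewrite lt_neqAle V_ge0 ?(ltW t0_gt0)// andbT eq_sym; apply/eqP => Vt0.
suff : 0 <= q t0 by rewrite leNgt qt0.
apply: q_eventually_nonneg => r tr.
apply: (@derive_le0_ge _ q dq t0 r tr) => [x /andP[tx _]|x _|x /andP[tx xr]].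
- by apply: q_is_derive; exact: lt_trans tx.
- exact: q_continuous.
- have x0 : 0 <= x by rewrite ltW// (lt_trans t0_gt0).
  have Vx : V x = 0.
    apply/eqP; rewrite eq_le V_ge0// andbT -Vt0.
    by apply: V_noninc; exact: ltW.
  by rewrite /dq Vx mulr0 mul0r.
Qed.

Let H r := (n + 2 - c) * V r + r * derive1 V r.

(* The difference of the Pohozaev functionals p^2/2 + c p + B r^(n+2) V e^g,
   p = flux g, of the two solutions; c is such that it vanishes at t0. *)
Let D r := 2^-1 * (flux g2 r * flux g2 r - flux g1 r * flux g1 r) + c * q r
  + B * (r `^ (n + 2) * V r) * (expR (g2 r) - expR (g1 r)).
Let dD r := B * r `^ (n + 1) * (expR (g2 r) - expR (g1 r)) * H r.

Let D_is_derive r : 0 < r -> is_derive r 1 D (dD r).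
Proof.
move=> r0; have rn0 : r != 0 by rewrite gt_eqF.
case: (sol1) => _ _ /(_ r r0) d1; case: (sol2) => _ _ /(_ r r0) d2.
have dp := is_deriveB_fun (is_deriveM_fun d2 d2) (is_deriveM_fun d1 d1).
have dw := is_deriveZ_fun B (power_profile_is_derive (n + 2) r0).
have de := is_deriveB_fun (is_derive_expR_comp (solution_is_derive sol2 rn0))
  (is_derive_expR_comp (solution_is_derive sol1 rn0)).
have dpq := is_deriveD_fun (is_deriveZ_fun 2^-1 dp) (is_deriveZ_fun c (q_is_derive r0)).
have dE := is_deriveD_fun dpq (is_deriveM_fun dw de).
apply: (is_derive_eq dE).
have -> : r `^ (n + 2 - 1) = r `^ (n + 1) by congr (r `^ _); lra.
have -> : r `^ (n + 2) = r `^ (n + 1) * r.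
  by rewrite -powRD1//; congr (r `^ _); lra.
by rewrite /dD /dq /H; field.
Qed.

Let D_continuous r : 0 < r -> {for r, continuous D}.
Proof. by move=> /D_is_derive/is_derive_continuous. Qed.

Let D_t0 : D t0 = 0.
Proof.
(* As $p_2^2 - p_1^2 = q (p_1 + p_2)$, the first two terms share the factor [q t0], whose cofactor
   [c] cancels; the last term vanishes since [d t0 = 0]. *)
have -> : D t0 = q t0 * ((flux g1 t0 + flux g2 t0) / 2 + c)
    + B * (t0 `^ (n + 2) * V t0) * (expR (g2 t0) - expR (g1 t0)).
  by rewrite /D /q; field.
have -> : g2 t0 = g1 t0 by move: dt0; rewrite /d; lra.
by rewrite subrr mulr0 addr0 /c; field.
Qed.

(* Where d does not vanish, D' and H have the same zeros. *)
Let H_eq0 (u v : R) : 0 < u -> (forall x, u < x < v -> D x = 0 /\ d x != 0) ->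
  forall x, u < x < v -> H x = 0.
Proof.
move=> u0 Dd x uxv; have x0 : 0 < x by case/andP: uxv => /(lt_trans u0).
have [_ dx] := Dd x uxv.
have : dD x = 0.
  have := @near_eq_is_derive _ _ _ (cst 0) D x 1 0 _ (is_derive_cst 0 x 1).
  move=> /(_ _)/@derive_val <-; first by rewrite (@derive_val _ _ _ _ _ _ _ (D_is_derive x0)).
  near=> y; have [] // := Dd y _.
  by near: y; apply: near_in_itvoo; rewrite in_itv.
rewrite /dD => /eqP; rewrite !mulf_eq0 gt_eqF//= gt_eqF ?powR_gt0//= => /orP[|/eqP//].
rewrite subr_eq0 => /eqP/expR_inj e; move: dx; rewrite /d e subrr eqxx //.
Unshelve. all: by end_near. Qed.

(** At 0 the fluxes vanish, the exponentials are finite and $r^{n+2} V \to 0$. A limit from the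
    right fits [D_is_derive] and [D_continuous], which cover $r > 0$. *)
Let D_cvg0_right : D r @[r --> 0^'+] --> 0.
Proof.
have cv (f : R -> R) : continuous f -> f r @[r --> 0^'+] --> f 0.
  by move=> fc; apply: cvg_at_right_filter; exact: fc.
have p1 := cv _ (flux_continuous sol1); have p2 := cv _ (flux_continuous sol2).
have qq := cv _ q_continuous.
have ce (g : R -> R) : radial_solution B n V g ->
    expR (g r) @[r --> 0^'+] --> expR (g 0).
  move=> sg; apply: cv => x; apply: (@continuous_comp _ _ _ g expR).
    exact: solution_continuous sg x.
  exact: continuous_expR.
have e1 := ce _ sol1; have e2 := ce _ sol2.
have n2 : 0 < n + 2 by rewrite ltr_wpDl.
rewrite [X in _ --> X](_ : 0 = 2^-1 * (flux g2 0 * flux g2 0 - flux g1 0 * flux g1 0)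
    + c * q 0 + B * 0 * (expR (g2 0) - expR (g1 0))).
  apply: cvgD; last first.
    apply: cvgM; last exact: cvgB.
    by apply: cvg_cstM; exact: power_profile_cvg0_right.
  apply: cvgD; last exact: cvg_cstM.
  by apply: cvg_cstM; apply: cvgB; exact: cvgM.
by rewrite /q !flux0 subrr; ring.
Qed.

(** The flux terms cancel in the limit, both fluxes tending to [m]. The difference of exponentials
    stays between $-e^{g_1(0)}$ and $e^{g_2(0)}$, and its weight tends to 0 by the decay of [V]. *)
Let D_cvg0_pinfty : D r @[r --> +oo] --> 0.
Proof.
have w : B * (r `^ (n + 2) * V r) @[r --> +oo] --> B * 0.
  by apply: cvg_cstM; exact: power_profile_cvg0_pinfty.
have we : B * (r `^ (n + 2) * V r) * (expR (g2 r) - expR (g1 r)) @[r --> +oo] --> 0.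
  apply: (@squeeze_cvgr _ _ _ _
    (fun r => B * (r `^ (n + 2) * V r) * - expR (g1 0))
    (fun r => B * (r `^ (n + 2) * V r) * expR (g2 0))).
  - near=> r.
    have r0 : 0 <= r by near: r; exact: nbhs_pinfty_ge.
    have w0 : 0 <= B * (r `^ (n + 2) * V r).
      by rewrite mulr_ge0 ?(ltW B_gt0)// mulr_ge0 ?powR_ge0 ?V_ge0.
    have h1 := solution_le0 B_gt0 V_ge0 sol1 r0.
    have h2 := solution_le0 B_gt0 V_ge0 sol2 r0.
    rewrite -ler_expR in h1; rewrite -ler_expR in h2.
    have := expR_ge0 (g1 r); have := expR_ge0 (g2 r) => e1 e2.
    by apply/andP; split; apply: ler_wpM2l => //; lra.
  - by rewrite -[X in _ --> X](mul0r (- expR (g1 0))) -(mulr0 B); exact: cvg_Mcst.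
  - by rewrite -[X in _ --> X](mul0r (expR (g2 0))) -(mulr0 B); exact: cvg_Mcst.
rewrite [X in _ --> X](_ : 0 = 2^-1 * (m * m - m * m) + c * 0 + 0); last by ring.
apply: cvgD => //; apply: cvgD; last exact: cvg_cstM.
by apply: cvg_cstM; apply: cvgB; exact: cvgM.
Unshelve. all: by end_near. Qed.

(** If $c \ge n+2$, both terms of [H] are nonpositive. Otherwise [V_sign] applies to $n+2-c$, and it
    remains to exclude that its sign change [rc] lies beyond [t0]. *)
Let H_le0 r : t0 <= r -> H r <= 0.
Proof.
move=> tr; have r0 : 0 < r by exact: lt_le_trans tr.
have [cn|cn] := leP (n + 2) c.
  rewrite -[leRHS]addr0 lerD//.
    by rewrite mulr_le0_ge0 ?V_ge0 ?(ltW r0)// subr_le0.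
  by rewrite mulr_ge0_le0 ?(ltW r0)// profile_derive_le0.
have a0 : 0 < n + 2 - c by rewrite subr_gt0.
have an : n + 2 - c < n + 2 by rewrite ltrBlDr ltrDl.
have [rc rc0 [Hpos Hneg]] := V_sign a0 an.
have [rct|trc] := leP rc t0; first by apply: Hneg; exact: le_trans tr.
exfalso.
(* If [t0 < rc], then [D] is nondecreasing on $(0,t_0]$ from the limit 0 to [D t0 = 0], so it
   vanishes there. *)
have D_le x y : 0 < x -> x <= y -> y <= t0 -> D x <= D y.
  move=> x0 xy yt; apply: (@derive_ge0_le _ D dD x y xy) => z.
  - by move=> /andP[xz _]; apply: D_is_derive; exact: lt_trans xz.
  - by move=> /andP[xz _]; apply: D_continuous; exact: lt_le_trans xz.
  - move=> /andP[xz zy]; have z0 : 0 < z by exact: lt_trans xz.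
    have zt : z < t0 by exact: lt_le_trans yt.
    rewrite /dD !mulr_ge0 ?powR_ge0 ?(ltW B_gt0)//.
      by rewrite subr_ge0 ler_expR; have := d_pos (ltW z0) zt; rewrite /d; lra.
    by apply: Hpos; [exact: ltW|exact: ltW (lt_trans zt trc)].
have D0 x : 0 < x -> x <= t0 -> D x = 0.
  move=> x0 xt; apply/eqP; rewrite eq_le -{1}D_t0 D_le//=.
  apply: (cvgr_to_le D_cvg0_right); near=> s.
  have s0 : 0 < s by near: s; exact: nbhs_right_gt.
  by apply: D_le => //; near: s; exact: nbhs_right_le.
(* The vanishing of [D] forces that of [H], so $r^{n+2-c} V$ is constant; its limit 0 at the origin
   then contradicts [V t0 > 0]. *)
have w_cst s : 0 < s -> s <= t0 ->
    s `^ (n + 2 - c) * V s = t0 `^ (n + 2 - c) * V t0.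
  move=> s0 st; apply: power_profile_cst => //.
  apply: H_eq0 => // x /andP[sx xt]; have x0 : 0 < x by exact: lt_trans sx.
  by rewrite D0 ?(ltW xt)//; split=> //; rewrite gt_eqF ?d_pos ?(ltW x0).
suff : t0 `^ (n + 2 - c) * V t0 <= 0 by rewrite leNgt mulr_gt0 ?powR_gt0.
apply: (cvgr_to_ge (power_profile_cvg0_right a0)); near=> s.
have s0 : 0 < s by near: s; exact: nbhs_right_gt.
by rewrite w_cst//; near: s; exact: nbhs_right_le.
Unshelve. all: by end_near. Qed.

Let d_lt0 (T : R) : (forall s, t0 <= s -> s < T -> q s < 0) ->
  forall x, t0 < x -> x <= T -> d x < 0.
Proof.
move=> qT x tx xT; rewrite -dt0.
apply: (@derive_lt0_gt _ d (fun r => q r / r) t0 x tx) => z.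
- by move=> /andP[tz _]; apply: d_is_derive; exact: lt_trans tz.
- by move=> _; exact: d_continuous.
- move=> /andP[tz zx]; rewrite pmulr_llt0 ?invr_gt0 ?(lt_trans t0_gt0)//.
  by rewrite qT ?(ltW tz)// (lt_le_trans zx).
Qed.

(** Past [t0] both $d < 0$ and $H \le 0$, so the product [dD] is nonnegative. *)
Let D_nondecreasing (T : R) : (forall s, t0 <= s -> s < T -> q s < 0) ->
  forall x y, t0 <= x -> x <= y -> y <= T -> D x <= D y.
Proof.
move=> qT x y tx xy yT.
have t_gt0 z : x <= z -> 0 < z by move=> xz; rewrite (lt_le_trans t0_gt0)// (le_trans tx).
apply: (@derive_ge0_le _ D dD x y xy) => z /andP[xz zy].
- by apply: D_is_derive; apply: t_gt0; exact: ltW.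
- by apply: D_continuous; exact: t_gt0.
- have z0 : 0 < z by apply: t_gt0; exact: ltW.
  have tz : t0 < z by exact: le_lt_trans xz.
  rewrite /dD mulr_le0 ?H_le0 ?(ltW tz)//.
  rewrite mulr_ge0_le0 ?mulr_ge0 ?powR_ge0 ?(ltW B_gt0)// subr_le0 ler_expR.
  by have := d_lt0 qT tz (ltW (lt_le_trans zy yT)); rewrite /d; lra.
Qed.

(** Monotonicity squeezes [D] between [D t0 = 0] and [D T <= 0]; so [D] vanishes on $[t_0,T]$ and
    [H] inside it. *)
Let power_profile_cst_after (T : R) : t0 < T ->
  (forall s, t0 <= s -> s < T -> q s < 0) -> D T <= 0 ->
  D T = 0 /\ T `^ (n + 2 - c) * V T = t0 `^ (n + 2 - c) * V t0.
Proof.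
move=> tT qT DT.
have D0 x : t0 <= x -> x <= T -> D x = 0.
  move=> tx xT; apply/eqP; rewrite eq_le (le_trans _ DT) ?(D_nondecreasing qT)//=.
  by rewrite -D_t0 (D_nondecreasing qT).
split; first by rewrite D0// ltW.
apply/esym/power_profile_cst => //; first exact: ltW.
apply: H_eq0 => // x /andP[tx xT].
by rewrite D0 ?(ltW tx) ?(ltW xT)//; split=> //; rewrite lt_eqF// (d_lt0 qT)// ltW.
Qed.

(** At a first zero [t1] of [q] the flux terms of [D] cancel, so [D t1 <= 0] because [d t1 < 0]. The
    squeeze then gives both [D t1 = 0] and [V t1 > 0], but the latter makes [D t1] strictly
    negative. *)
Let q_lt0_after s : t0 <= s -> q s < 0.
Proof.
move=> ts; rewrite ltNge; apply/negP => qs.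
have [|||t1 [tt1 qt1 qneg]] := @first_zero _ (fun r => - q r) t0 s _ ts.
- by move=> x; apply: continuousN; exact: q_continuous.
- by rewrite oppr_gt0.
- by rewrite oppr_le0.
have t10 : 0 < t1 by exact: lt_trans tt1.
have qlt r : t0 <= r -> r < t1 -> q r < 0.
  by move=> tr rt; rewrite -oppr_gt0; exact: qneg.
have q1 : q t1 = 0 by apply/eqP; rewrite -oppr_eq0; apply/eqP.
have e1 : expR (g2 t1) - expR (g1 t1) < 0.
  rewrite subr_lt0 ltr_expR.
  by have := d_lt0 qlt tt1 (lexx _); rewrite /d; lra.
have DE : D t1 = B * (t1 `^ (n + 2) * V t1) * (expR (g2 t1) - expR (g1 t1)).
  have fE : flux g2 t1 = flux g1 t1 by move: q1; rewrite /q; lra.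
  by rewrite /D q1 fE subrr !mulr0 !add0r.
have DT : D t1 <= 0.
  by rewrite DE mulr_ge0_le0 ?(ltW e1)// !mulr_ge0 ?powR_ge0 ?V_ge0 ?(ltW t10) ?(ltW B_gt0).
have [D0 Vt1] := power_profile_cst_after tt1 qlt DT.
have V1 : 0 < V t1.
  rewrite -(@pmulr_rgt0 _ (t1 `^ (n + 2 - c))) ?powR_gt0// Vt1.
  by rewrite mulr_gt0 ?powR_gt0.
have : D t1 < 0 by rewrite DE pmulr_rlt0// !mulr_gt0 ?powR_gt0.
by rewrite D0 ltxx.
Qed.

(** Now [D] is nondecreasing on $[t_0,\infty)$ with limit 0, hence nonpositive. The squeeze makes
    $r^{n+2-c} V$ constant past [t0], whereas the decay hypothesis sends it to 0. *)
Lemma energy_contradiction : False.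
Proof.
have qlt T s : t0 <= s -> s < T -> q s < 0 by move=> ts _; exact: q_lt0_after.
have DT (T : R) : t0 <= T -> D T <= 0.
  move=> tT; apply: (cvgr_to_ge D_cvg0_pinfty); near=> r.
  have Tr : T <= r by near: r; apply: nbhs_pinfty_ge; exact: num_real.
  exact: (D_nondecreasing (qlt r)).
have : t0 `^ (n + 2 - c) * V t0 <= 0.
  have cn : n + 2 - c <= n + 2 by rewrite lerBlDr lerDl ltW.
  apply: (cvgr_to_ge (power_profile_cvg0_pinfty cn)); near=> r.
  have tr : t0 < r by near: r; apply: nbhs_pinfty_gt; exact: num_real.
  by have [_ ->] := power_profile_cst_after tr (qlt r) (DT r (ltW tr)).
by rewrite leNgt mulr_gt0 ?powR_gt0.
Unshelve. all: by end_near. Qed.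

End Energy.

Lemma equal_flux_contradiction : False.
Proof.
by have [t0 [t00 dt0 dpos]] := d_crosses; exact: energy_contradiction t00 dt0 dpos.
Qed.

End Crossing.

(** * Areas of discs and integrals of radial functions over the plane *)

Section Discs.
Context {R : realType}.
Local Notation mu := (@lebesgue_measure R \x @lebesgue_measure R)%E.
Local Notation plane := (measurableTypeR R * measurableTypeR R)%type.
Implicit Types r a b : R.

Definition disc r : set plane := [set p | enorm p <= r].

Lemma enorm_ge0 (p : R * R) : 0 <= enorm p.
Proof. exact: sqrtr_ge0. Qed.

Lemma enorm_scale a (p : R * R) : 0 <= a -> enorm (a * p.1, a * p.2) = a * enorm p.
Proof.
move=> a0; rewrite /enorm /= !exprMn -mulrDr sqrtrM ?sqr_ge0//.
by rewrite sqrtr_sqr ger0_norm.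
Qed.

Lemma measurable_enorm : measurable_fun setT (@enorm R : plane -> measurableTypeR R).
Proof.
apply: (@measurableT_comp _ _ _ _ _ _ (@Num.sqrt R : measurableTypeR R -> measurableTypeR R)).
  by apply: continuous_measurable_fun; exact: sqrt_continuous.
by apply: measurable_funD; apply: measurable_funX; [exact: measurable_fst|exact: measurable_snd].
Qed.

Lemma measurable_disc r : measurable (disc r).
Proof.
have -> : disc r = @enorm R @^-1` `]-oo, r].
  by apply/seteqP; split => p /=; rewrite in_itv.
by rewrite -[X in measurable X]setTI; apply: measurable_enorm.
Qed.

(** Presents the pushforward as an abstract measure known by its values, ready for the uniqueness
    theorems for measures. *)
Lemma ex_pushforward_measure d d' (T1 : measurableType d) (T2 : measurableType d')
    (m : {measure set T1 -> \bar R}) (f : T1 -> T2) : measurable_fun setT f ->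
  exists nu : {measure set T2 -> \bar R}, forall B, nu B = m (f @^-1` B).
Proof. by move=> mf; unshelve eexists; [exact: (pushforward m f)|]. Qed.

Lemma measurable_scale a :
  measurable_fun setT ((fun x => a * x) : measurableTypeR R -> measurableTypeR R).
Proof. by apply: measurable_funM => //; exact: measurable_cst. Qed.

(** The right-hand side is a measure in [A] that gives half-open intervals their length, so
    uniqueness of Lebesgue measure applies. *)
Lemma lebesgue_measure_scale a (A : set (measurableTypeR R)) : 0 < a -> measurable A ->
  (lebesgue_measure A = a%:E * lebesgue_measure ((fun x => (a * x)%R) @^-1` A))%E.
Proof.
move=> a0 mA; have a0' := ltW a0.
have [nu nuE] := ex_pushforward_measure (@lebesgue_measure R) (measurable_scale a).
rewrite -nuE (@lebesgue_measure_unique _ (mscale (NngNum a0') nu))//.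
move=> _ [[x y] _ <-]; rewrite /mscale/=.
transitivity (a%:E * lebesgue_measure `](x / a)%R, (y / a)%R]%classic)%E; last first.
  congr (_ * _)%E; rewrite nuE; congr lebesgue_measure; apply/seteqP; split => z /=;
    by rewrite !in_itv /= ltr_pdivrMr// ler_pdivlMr// ![z * a]mulrC.
rewrite !lebesgue_measure_itv /= !lte_fin ltr_pM2r ?invr_gt0//.
case: ifP => _; last by rewrite mule0.
by rewrite -!EFinB -EFinM -mulrBl mulrC divfK// gt_eqF.
Qed.

(** On rectangles this is the scaling of each factor; uniqueness of the product measure extends
    it. *)
Lemma plane_measure_scale a (A : set plane) : 0 < a -> measurable A ->
  (mu A = (a ^+ 2)%:E * mu ((fun p : plane => (a * p.1, a * p.2)%R) @^-1` A))%E.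
Proof.
move=> a0 mA; have a2 : 0 <= a ^+ 2 by exact: sqr_ge0.
have ms : measurable_fun setT ((fun p => (a * p.1, a * p.2)) : plane -> plane).
  apply: measurable_fun_pair; apply: (measurableT_comp (measurable_scale a)).
    exact: measurable_fst.
  exact: measurable_snd.
have [nu nuE'] := ex_pushforward_measure mu ms.
have nuE B : nu B = mu ((fun p : plane => (a * p.1, a * p.2)) @^-1` B) by exact: nuE'.
rewrite -nuE (@product_measure_unique _ _ _ _ _ _ _ (mscale (NngNum a2) nu))//.
move=> B1 B2 mB1 mB2; transitivity ((a ^+ 2)%:E * nu (B1 `*` B2))%E => //.
rewrite nuE.
have -> : (fun p : plane => (a * p.1, a * p.2)) @^-1` (B1 `*` B2) =
  ((fun x => a * x) @^-1` B1) `*` ((fun x => a * x) @^-1` B2) by [].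
rewrite product_measure1E//; last 2 first.
- by rewrite -[X in measurable X]setTI; exact: measurable_scale.
- by rewrite -[X in measurable X]setTI; exact: measurable_scale.
transitivity (lebesgue_measure B1 * lebesgue_measure B2)%E => //.
rewrite (lebesgue_measure_scale a0 mB1) (lebesgue_measure_scale a0 mB2).
by rewrite expr2 EFinM muleACA.
Qed.

Lemma plane_measureX (A B : set (measurableTypeR R)) : measurable A -> measurable B ->
  mu (A `*` B) = (lebesgue_measure A * lebesgue_measure B)%E.
Proof. exact: product_measure1E. Qed.

Lemma disc1_fin : (mu (disc 1) < +oo)%E.
Proof.
apply: (@le_lt_trans _ _ (mu (`[-1, 1]%classic `*` `[-1, 1]%classic))).
  apply: le_measure; rewrite ?inE; [exact: measurable_disc|exact: measurableX|].
  move=> p; rewrite /disc /enorm /= => p1.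
  have sq : p.1 ^+ 2 + p.2 ^+ 2 <= 1.
    by rewrite -(@ler_sqrt _ _ 1)// sqrtr1.
  have := sqr_ge0 p.1; have := sqr_ge0 p.2 => h1 h2.
  have sq1 (x : R) : x ^+ 2 <= 1 -> -1 <= x <= 1 by move=> x1; apply/andP; split; nra.
  by rewrite !in_itv /=; split; apply: sq1; lra.
rewrite plane_measureX// !lebesgue_measure_itv /= lte_fin.
by case: ifP; rewrite ?mul0e// -EFinB -EFinM ltry.
Qed.

Lemma disc1_gt0 : (0 < mu (disc 1))%E.
Proof.
apply: (@lt_le_trans _ _ (mu (`[0, 1/2]%classic `*` `[0, 1/2]%classic))).
  rewrite plane_measureX// !lebesgue_measure_itv /= lte_fin ifT; last by lra.
  by rewrite -EFinB -EFinM lte_fin; lra.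
apply: le_measure; rewrite ?inE; [exact: measurableX|exact: measurable_disc|].
move=> p [] /=; rewrite !in_itv /= => /andP[p1 p1'] /andP[p2 p2'].
by rewrite /disc /enorm /= -sqrtr1 ler_sqrt//; nra.
Qed.

(** This is $\pi$, treated as an abstract positive constant; it enters the flux limit, which is the
    same for both solutions. *)
Definition disc_area : R := fine (mu (disc 1)).

Lemma disc_area_gt0 : 0 < disc_area.
Proof. by rewrite fine_gt0// disc1_gt0 disc1_fin. Qed.

Lemma measure_disc r : 0 <= r -> mu (disc r) = (disc_area * r ^+ 2)%:E.
Proof.
rewrite le_eqVlt => /predU1P[<-|r0].
  (* For $r = 0$ the disc is a single point and not a positive scaling of the unit disc. *)
  rewrite expr0n mulr0.
  have -> : disc 0 = [set 0] `*` [set 0].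
    apply/seteqP; split => p /=; rewrite /disc /enorm /=.
      rewrite le_eqVlt ltNge sqrtr_ge0 orbF sqrtr_eq0 => p0.
      have := sqr_ge0 p.1; have := sqr_ge0 p.2 => h1 h2.
      by split; apply/eqP; rewrite -sqrf_eq0; apply/eqP; lra.
    by move=> [-> ->]; rewrite expr0n addr0 sqrtr0.
  by rewrite plane_measureX// lebesgue_measure_set1 mul0e.
rewrite (plane_measure_scale r0 (measurable_disc r)).
transitivity ((r ^+ 2)%:E * disc_area%:E)%E; last by rewrite -EFinM mulrC.
congr (_ * _)%E.
rewrite /disc_area fineK ?ge0_fin_numE ?disc1_fin//; congr (product_measure1 _ _ _).
apply/seteqP; split => p; rewrite /disc /= enorm_scale ?(ltW r0)//.
  by rewrite ger_pMr.
by rewrite ger_pMr.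
Qed.

(** * Mass of a radial density in discs as a function of the radius *)

Section RadialIntegral.
Context (F : R -> R) (F_ge0 : forall r, 0 <= r -> 0 <= F r)
  (F_meas : measurable_fun setT (F : measurableTypeR R -> measurableTypeR R)).

Let f (p : plane) : \bar R := (F (enorm p))%:E.

Let f_ge0 p : (0 <= f p)%E.
Proof. by rewrite lee_fin F_ge0 ?enorm_ge0. Qed.

Let f_meas (D : set plane) : measurable_fun D f.
Proof.
apply: (@measurable_funS _ _ _ _ setT) => //.
apply/measurable_EFinP; exact: (measurableT_comp F_meas measurable_enorm).
Qed.

Context (f_total : (\int[mu]_p f p = 1)%E).

Definition disc_integral r : R := fine (\int[mu]_(p in disc r) (F (enorm p))%:E).

Let disc_integral_le1 r : (\int[mu]_(p in disc r) f p <= 1)%E.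
Proof.
rewrite -f_total; apply: ge0_subset_integral => //; exact: measurable_disc.
Qed.

Lemma disc_integralE r : (\int[mu]_(p in disc r) (F (enorm p))%:E)%E = (disc_integral r)%:E.
Proof.
rewrite /disc_integral fineK// ge0_fin_numE; last first.
  by apply: integral_ge0 => p _; exact: f_ge0.
by rewrite (le_lt_trans (disc_integral_le1 r))// ltry.
Qed.

Lemma measure_annulus a b : 0 <= a -> a <= b ->
  mu (disc b `\` disc a) = (disc_area * (b ^+ 2 - a ^+ 2))%:E.
Proof.
move=> a0 ab; have b0 : 0 <= b by exact: le_trans ab.
rewrite measureD; [|exact: measurable_disc|exact: measurable_disc|].
  rewrite (_ : disc b `&` disc a = disc a); last first.
    by apply: setIidr => p; rewrite /disc /= => /le_trans; exact.
  transitivity (mu (disc b) - mu (disc a))%E => //.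
  by rewrite !measure_disc// -EFinB mulrBr.
apply: (@le_lt_trans _ _ (disc_area * b ^+ 2)%:E); last by rewrite ltry.
by rewrite -measure_disc.
Qed.

Lemma disc_integralD a b : 0 <= a -> a <= b ->
  (disc_integral b)%:E = ((disc_integral a)%:E +
   \int[mu]_(p in disc b `\` disc a) (F (enorm p))%:E)%E.
Proof.
move=> a0 ab; rewrite -!disc_integralE.
have mab : measurable (disc b `\` disc a) by apply: measurableD; exact: measurable_disc.
rewrite -(ge0_integral_setU mu (measurable_disc a) mab (@f_meas _) (fun p _ => f_ge0 p)).
  congr integral; apply/seteqP; split => p; rewrite /disc /=.
    move=> pb; have [|pa] := leP (enorm p) a; first by left.
    by right; split=> //; apply/negP; rewrite -ltNge.
  by case=> [/le_trans|[]//]; exact.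
by apply/disj_setPS => p [] pa [_]; exact.
Qed.

Lemma disc_integral_bounds a b l u : 0 <= a -> a <= b -> 0 <= l ->
  (forall x, a <= x <= b -> l <= F x <= u) ->
  l * (disc_area * (b ^+ 2 - a ^+ 2)) <= disc_integral b - disc_integral a
    <= u * (disc_area * (b ^+ 2 - a ^+ 2)).
Proof.
move=> a0 ab l0 lFu.
have mab : measurable (disc b `\` disc a) by apply: measurableD; exact: measurable_disc.
have lu p : (disc b `\` disc a) p -> l <= F (enorm p) <= u.
  by move=> [pb /negP]; rewrite -ltNge => pa; apply: lFu; rewrite pb (ltW pa).
rewrite lerBrDl lerBlDl -!lee_fin (disc_integralD a0 ab) !EFinD.
apply/andP; split; apply: leeD2l.
  rewrite EFinM -measure_annulus// -integral_cst//.
  by apply: ge0_le_integral => // p /lu /andP[]; rewrite lee_fin.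
rewrite EFinM -measure_annulus// -integral_cst//.
apply: ge0_le_integral => // p; first by move=> _; exact: f_ge0.
by move=> /lu /andP[_ Fu]; rewrite lee_fin.
Qed.


(** Stands in for polar coordinates: on a thin annulus the integrand is close to [F r], and with $C$
    the area of the unit disc the annulus has area $C |y^2 - r^2|$. *)
Lemma disc_integral_is_derive r : 0 < r -> {for r, continuous F} ->
  is_derive r 1 disc_integral (2 * disc_area * r * F r).
Proof.
move=> r0 Fc; have C0 := disc_area_gt0; set C := disc_area in C0 *.
apply: is_derive_of_bound => e e0.
have Fr0 : 0 <= F r by rewrite F_ge0 ?ltW.
have X0 : 0 < C * (2 * r + 1) by rewrite mulr_gt0//; lra.
(* The error is split in halves: [e'] bounds the oscillation of [F], with $2r + 1$ bounding $y + r$,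
   and [h] below controls the quadratic remainder $F(r) C (y - r)^2$. *)
pose e' : R := e / 2 / (C * (2 * r + 1)).
have e'0 : 0 < e' by rewrite !divr_gt0.
have e'E : e' * (C * (2 * r + 1)) = e / 2 by rewrite divfK// gt_eqF.
pose h : R := e / 2 / (F r * C + 1).
have FC : 0 <= F r * C by rewrite mulr_ge0 ?(ltW C0).
have FC1 : 0 < F r * C + 1 by lra.
have h0 : 0 < h by rewrite !divr_gt0.
have hE : F r * C * h <= e / 2.
  have -> : e / 2 = (F r * C + 1) * h by rewrite /h [RHS]mulrC divfK// gt_eqF.
  by rewrite ler_wpM2r ?(ltW h0)//; lra.
have /nbhs_ballP[d0 /= d00 Hd] : \forall y \near r, `|F r - F y| <= e'.
  by move/cvgrPdist_le : Fc; apply.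
have bound a b : 0 < a -> a <= b -> (forall x, a <= x <= b -> `|r - x| < d0) ->
    `|disc_integral b - disc_integral a - F r * C * (b ^+ 2 - a ^+ 2)|
      <= e' * C * (b ^+ 2 - a ^+ 2).
  move=> a0 ab Hx.
  (* Cut off at 0 because [disc_integral_bounds] asks for a nonnegative lower bound. *)
  pose l : R := Num.max 0 (F r - e').
  have := @disc_integral_bounds a b l (F r + e') (ltW a0) ab.
  rewrite le_max lexx => /(_ isT) bd.
  have /bd : forall x, a <= x <= b -> l <= F x <= F r + e'.
    move=> x axb; have := Hd x (Hx x axb); rewrite ler_norml => /andP[h1 h2].
    rewrite ge_max F_ge0 /=; last by case/andP: axb => /(lt_le_trans a0) /ltW.
    by apply/andP; split; lra.
  have S0 : 0 <= C * (b ^+ 2 - a ^+ 2).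
    by rewrite mulr_ge0 ?(ltW C0)// subr_ge0 ler_sqr ?nnegrE ?(ltW a0)// (le_trans (ltW a0)).
  have lS : (F r - e') * (C * (b ^+ 2 - a ^+ 2)) <= l * (C * (b ^+ 2 - a ^+ 2)).
    by rewrite ler_wpM2r// le_max lexx orbT.
  rewrite -/C => /andP[h1 h2]; rewrite ler_norml; apply/andP; split; lra.
(* In this radius [r] keeps $y$ positive and 1 gives $y + r \le 2r + 1$. *)
have main y : `|r - y| < Num.min d0 (Num.min h (Num.min 1 r)) ->
    `|disc_integral y - disc_integral r - F r * C * (y ^+ 2 - r ^+ 2)|
      <= e' * C * `|y ^+ 2 - r ^+ 2|.
  rewrite !lt_min => /and4P[yd _ _ yr].
  have y0 : 0 < y by move: yr; rewrite ltr_norml => /andP[_]; lra.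
  have [ry|yr'] := leP r y.
    rewrite [`|y ^+ 2 - _|]ger0_norm; last first.
      by rewrite subr_ge0 ler_sqr ?nnegrE ?(ltW r0) ?(ltW y0).
    apply: bound => // x /andP[rx xy]; apply: le_lt_trans yd.
    by rewrite !ler0_norm; lra.
  have -> : disc_integral y - disc_integral r - F r * C * (y ^+ 2 - r ^+ 2) =
    - (disc_integral r - disc_integral y - F r * C * (r ^+ 2 - y ^+ 2)) by ring.
  have nE : `|y ^+ 2 - r ^+ 2| = r ^+ 2 - y ^+ 2.
    rewrite distrC ger0_norm//.
    by rewrite subr_ge0 ler_sqr ?nnegrE ?(ltW r0) ?(ltW y0) ?ry ?(ltW yr').
  rewrite normrN nE; apply: bound => //; first exact: ltW.
  move=> x /andP[yx xr]; apply: le_lt_trans yd.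
  by rewrite !ger0_norm; lra.
apply/nbhs_ballP; exists (Num.min d0 (Num.min h (Num.min 1 r))).
  by rewrite /= !lt_min d00 h0 r0 ltr01.
move=> y yr; have := main y yr; move: yr.
rewrite /ball /= !lt_min => /and4P[_ yh y1 yr].
have -> : y ^+ 2 - r ^+ 2 = (y - r) * (y + r) by ring.
rewrite distrC in yh y1 yr *.
set t := `|y - r| in yh y1 yr *.
have yr0 : 0 <= y + r.
  by move: yr; rewrite /t ltr_norml => /andP[]; lra.
have yr2 : y + r <= 2 * r + 1.
  by move: y1; rewrite /t ltr_norml => /andP[]; lra.
rewrite normrM (ger0_norm yr0) -/t => Hy.
have t0 : 0 <= t by exact: normr_ge0.
have -> : disc_integral y - disc_integral r - 2 * C * r * F r * (y - r) =
  (disc_integral y - disc_integral r - F r * C * ((y - r) * (y + r)))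
  + F r * C * ((y - r) * (y - r)) by ring.
apply: (le_trans (ler_normD _ _)).
have -> : e * t = e / 2 * t + e / 2 * t by field.
apply: lerD.
  apply: (le_trans Hy); rewrite -e'E.
  have -> : e' * C * (t * (y + r)) = e' * C * (y + r) * t by ring.
  rewrite ler_wpM2r// -mulrA ler_wpM2l ?(ltW e'0)// ler_wpM2l// ltW//.
rewrite normrM (ger0_norm FC) normrM -/t mulrA ler_wpM2r//.
by rewrite (le_trans _ hE)// ler_wpM2l// ltW.
Qed.

Lemma disc_integral_nondecreasing a b : a <= b -> disc_integral a <= disc_integral b.
Proof.
move=> ab; rewrite -lee_fin -!disc_integralE.
apply: ge0_subset_integral; [exact: measurable_disc|exact: measurable_disc|exact: f_meas| |].
  by move=> p _; exact: f_ge0.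
by move=> p; rewrite /disc /= => /le_trans; exact.
Qed.

(** Along the integers the discs increase to the whole plane; monotonicity in the radius passes to
    real [r]. *)
Lemma disc_integral_cvg1 : disc_integral r @[r --> +oo] --> (1 : R).
Proof.
have le1 r : disc_integral r <= 1 by rewrite -lee_fin -disc_integralE disc_integral_le1.
have cvn : disc_integral k%:R @[k --> \oo] --> (1 : R).
  suff /fine_cvgP[_] : (\int[mu]_(p in disc k%:R) f p)%E @[k --> \oo] --> (1 : R)%:E by exact.
  have -> : (1 : R)%:E = (\int[mu]_(p in \bigcup_k disc k%:R) f p)%E.
    rewrite -f_total; congr integral; apply/seteqP; split => p _ //.
    exists (Num.truncn (enorm p)).+1 => //; rewrite /disc /=; apply: ltW.
    by have /andP[] := truncn_itv (enorm_ge0 p).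
  apply: ge0_nondecreasing_set_cvg_integral => //.
  - move=> k l kl; apply/subsetPset => p; rewrite /disc /= => /le_trans; apply.
    by rewrite ler_nat.
  - by move=> k; exact: measurable_disc.
apply/cvgrPdist_le => e e0.
have /cvgrPdist_le /(_ e e0) [k _ Hk] := cvn.
near=> r; have kr : k%:R <= r.
  by near: r; apply: nbhs_pinfty_ge; exact: num_real.
have := Hk k (leqnn k); have := disc_integral_nondecreasing kr; have := le1 r.
by have := le1 k%:R => h1 h2 h3; rewrite !ger0_norm; lra.
Unshelve. all: by end_near. Qed.

Lemma disc_integral_cvg0 (M : R) : (forall r, 0 <= r <= 1 -> F r <= M) ->
  disc_integral r @[r --> 0^'+] --> (0 : R).
Proof.
move=> FM.
apply: (@squeeze_cvgr _ _ _ _ (fun=> 0) (fun r => M * (disc_area * (r * r)))).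
- near=> r.
  have r0 : 0 < r by near: r; exact: nbhs_right_gt.
  have r1 : r <= 1 by near: r; exact: nbhs_right_le.
  apply/andP; split.
    by rewrite -lee_fin -disc_integralE; apply: integral_ge0 => p _; exact: f_ge0.
  rewrite -lee_fin -disc_integralE -expr2 EFinM -measure_disc ?(ltW r0)//.
  rewrite -integral_cst; last exact: measurable_disc.
  apply: ge0_le_integral => //.
  + exact: measurable_disc.
  + by move=> p _; exact: f_ge0.
  + by move=> p pr; rewrite lee_fin FM// enorm_ge0 (le_trans pr).
- exact: cvg_cst.
- rewrite [X in _ --> X](_ : 0 = M * (disc_area * (0 * 0))); last by rewrite !mulr0.
  apply: cvg_at_right_filter; apply: cvg_cstM; apply: cvg_cstM.
  by apply: cvgM; exact: cvg_id.
Unshelve. all: by end_near. Qed.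

(* r F(r) integrates to the mass of the discs up to the factor 2 pi, which is
   kept as twice the area of the unit disc. *)
Lemma radial_mass (M : R) (P : R -> R) : (forall r, 0 <= r <= 1 -> F r <= M) ->
  (forall r, 0 < r -> {for r, continuous F}) ->
  continuous P -> P 0 = 0 -> (forall r, 0 < r -> is_derive r 1 P (r * F r)) ->
  P r @[r --> +oo] --> (2 * disc_area)^-1.
Proof.
move=> FM Fc Pc P0 dP; have C0 := disc_area_gt0.
(* [Z] is constant on $(0,\infty)$, where the derivatives are known; its limit from the right at 0
   identifies the constant as 0. *)
pose Z r := disc_integral r - 2 * disc_area * P r.
have dZ r : 0 < r -> is_derive r 1 Z 0.
  move=> r0; apply: is_derive_eq.
    exact: is_deriveB_fun (disc_integral_is_derive r0 (Fc r r0))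
      (is_deriveZ_fun (2 * disc_area) (dP r r0)).
  by ring.
have Z_cst s r : 0 < s -> s <= r -> Z s = Z r.
  move=> s0 sr; apply: (@derive_eq0_cst _ Z (cst 0) s r) => // x.
    by move=> /andP[sx _]; apply: dZ; exact: lt_trans sx.
  move=> /andP[sx _]; have /dZ/is_derive_continuous : 0 < x by exact: lt_le_trans sx.
  exact.
have Z0 : Z s @[s --> 0^'+] --> (0 : R).
  rewrite [X in _ --> X](_ : 0 = 0 - 2 * disc_area * P 0); last by rewrite P0 mulr0 subr0.
  apply: cvgB; first exact: disc_integral_cvg0 FM.
  by apply: cvg_cstM; apply: cvg_at_right_filter; exact: Pc.
have Zr r : 0 < r -> Z r = 0.
  move=> r0; apply: (cvg_unique _ _ Z0) => //.
  apply: cvg_near_cst; near=> s.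
  by apply: Z_cst; near: s; [exact: nbhs_right_gt|exact: nbhs_right_le].
rewrite -[X in _ --> X]mulr1.
apply: cvg_trans (cvg_cstM (k := (2 * disc_area)^-1) disc_integral_cvg1).
apply: near_eq_cvg; near=> r.
have r0 : 0 < r by near: r; exact: nbhs_pinfty_gt.
have := Zr r r0; rewrite /Z => /eqP; rewrite subr_eq0 => /eqP ->.
by rewrite mulKf// gt_eqF// mulr_gt0.
Unshelve. all: by end_near. Qed.

End RadialIntegral.

End Discs.

(** * Uniqueness for the radial equation, by trichotomy on the values at 0 *)

Lemma radial_solution_unique {R : realType} (B n : R) (V : R -> R) (g1 g2 : R -> R) (m : R) :
  0 < B -> 0 <= n -> (forall r : R, 0 <= r -> 0 <= V r) ->
  (forall r s : R, 0 <= r -> r <= s -> V s <= V r) ->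
  (forall r : R, 0 < r -> derivable V r 1) ->
  (exists2 delta : R, 0 < delta &
    exists M : R, forall r : R, 0 <= r -> r `^ (n + 2 + delta) * V r <= M) ->
  (forall c : R, 0 < c -> c < n + 2 -> exists2 rc : R, 0 < rc &
    (forall r : R, 0 <= r -> r <= rc -> 0 <= c * V r + r * derive1 V r) /\
    (forall r : R, rc <= r -> c * V r + r * derive1 V r <= 0)) ->
  radial_solution B n V g1 -> radial_solution B n V g2 ->
  flux g1 r @[r --> +oo] --> m -> flux g2 r @[r --> +oo] --> m -> m != 0 ->
  forall r, 0 <= r -> g1 r = g2 r.
Proof.
move=> B0 n0 V0 Vn Vd Vdec Vs s1 s2 l1 l2 m0 r r0.
have [g12|g21|g12] := ltgtP (g1 0) (g2 0).
- by case: (equal_flux_contradiction B0 n0 V0 Vn Vd Vdec Vs s1 s2 l1 l2 m0 g12).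
- by case: (equal_flux_contradiction B0 n0 V0 Vn Vd Vdec Vs s2 s1 l2 l1 m0 g21).
- exact: (solution_unique B0 n0 V0 Vn s1 s2 g12 r0).
Qed.

(** * Partial derivatives and the Laplacian of radial functions *)

Section Reduction.
Context {R : realType}.
Implicit Types (f V psi : R * R -> R) (x y r : R).

Let slice_e1 f x y :
  (fun h : R => h^-1 *: ((f \o shift (x, y)) (h *: e1 R) - f (x, y))) =
  (fun h : R => h^-1 *: (((fun s => f (s, y)) \o shift x) (h *: 1) - f (x, y))).
Proof.
apply/funext => h /=; congr (_ *: (f _ - _)).
by congr (_, _); transitivity (h * 0 + y); [by []|by rewrite mulr0 add0r].
Qed.

Let slice_e2 f x y :
  (fun h : R => h^-1 *: ((f \o shift (x, y)) (h *: e2 R) - f (x, y))) =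
  (fun h : R => h^-1 *: (((fun s => f (x, s)) \o shift y) (h *: 1) - f (x, y))).
Proof.
apply/funext => h /=; congr (_ *: (f _ - _)).
by congr (_, _); transitivity (h * 0 + x); [by []|by rewrite mulr0 add0r].
Qed.

Lemma derive_e1E f x y : 'D_(e1 R) f (x, y) = derive1 (fun s => f (s, y)) x.
Proof. by rewrite derive1E /derive slice_e1. Qed.

Lemma derivable_e1E f x y : derivable f (x, y) (e1 R) = derivable (fun s => f (s, y)) x 1.
Proof. by rewrite /derivable slice_e1. Qed.

Lemma derive_e2E f x y : 'D_(e2 R) f (x, y) = derive1 (fun s => f (x, s)) y.
Proof. by rewrite derive1E /derive slice_e2. Qed.

Lemma enorm_axis r : 0 <= r -> enorm (r, 0) = r.
Proof. by move=> r0; rewrite /enorm /= expr0n addr0 sqrtr_sqr ger0_norm. Qed.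

Lemma profile_enorm f p : radially_symmetric f -> f p = profile f (enorm p).
Proof. by move=> fr; apply: fr; rewrite enorm_axis// sqrtr_ge0. Qed.

Lemma profile_continuous f : (forall p, {for p, continuous f}) -> continuous (profile f).
Proof.
move=> fc r; apply: (@continuous_comp _ _ _ (fun s => (s, 0)) f); last exact: fc.
exact: (@cvg_pair _ _ _ (nbhs r) (nbhs r) (nbhs (0 : R)) _ _ _ id (cst 0) cvg_id (cvg_cst 0)).
Qed.

Lemma derive1_profile f : derive1 (profile f) = profile ('D_(e1 R) f).
Proof. by apply/funext => r; apply/esym; exact: derive_e1E. Qed.

(** Along the axis the second derivative is $g''$. Across it $\psi(r,t) = g(\rho(t))$ with $\rho(t)
    = \sqrt{r^2 + t^2}$, which contributes $g'(r)/r$. *)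
Lemma laplacian_radial psi r : radially_symmetric psi -> classC 2 [set: R * R] psi ->
  0 < r -> laplacian psi (r, 0) =
    derive1 (derive1 (profile psi)) r + derive1 (profile psi) r / r.
Proof.
move=> rad [_ [der [_ [der1 _ _]] _]] r0.
have E1 : 'D_(e1 R) ('D_(e1 R) psi) (r, 0) = derive1 (derive1 (profile psi)) r.
  transitivity (derive1 (profile ('D_(e1 R) psi)) r); first exact: derive_e1E.
  by congr (derive1 _ r); exact: esym (derive1_profile psi).
suff E2 : 'D_(e2 R) ('D_(e2 R) psi) (r, 0) = derive1 (profile psi) r / r.
  by rewrite /laplacian E1 E2.
pose g := profile psi; pose rho (t : R) : R := Num.sqrt (r ^+ 2 + t ^+ 2).
have dg (s : R) : derivable g s 1 by rewrite -(derivable_e1E psi s 0); exact: (der (s, 0) I).1.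
have dg1 (s : R) : derivable (derive1 g) s 1.
  by rewrite derive1_profile -(derivable_e1E ('D_(e1 R) psi) s 0); exact: (der1 (s, 0) I).1.
have sq_gt0 t : 0 < r ^+ 2 + t ^+ 2.
  by have := exprn_gt0 2 r0; have := sqr_ge0 t; lra.
have rho_gt0 t : 0 < rho t by rewrite sqrtr_gt0.
have drho (t : R) : is_derive t 1 rho (t / rho t).
  have dsq : is_derive t 1 (fun s => r ^+ 2 + s ^+ 2) (2 * t).
    have dsum := is_deriveD_fun (is_derive_cst (r ^+ 2) t 1)
      (is_deriveM_fun (is_derive_id t 1) (is_derive_id t 1)).
    by apply: (is_derive_eq dsum); rewrite add0r /=; ring.
  have -> : t / rho t = (2 * rho t)^-1 * (2 * t) by field; rewrite gt_eqF.
  exact: (is_derive1_comp (f := Num.sqrt) (g := fun s => r ^+ 2 + s ^+ 2)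
    (is_derive1_sqrt (sq_gt0 t)) dsq).
have psiE (t : R) : psi (r, t) = g (rho t).
  by rewrite (profile_enorm (r, t) rad).
have d2 (t : R) : 'D_(e2 R) psi (r, t) = derive1 g (rho t) * (t / rho t).
  rewrite derive_e2E (_ : (fun s => psi (r, s)) = g \o rho); last exact/funext.
  rewrite derive1E; apply: derive_val.
  apply: is_derive1_comp; rewrite derive1E; exact: derivableP.
rewrite derive_e2E (_ : (fun s => 'D_(e2 R) psi (r, s)) =
  (fun t => derive1 g (rho t) * (t * (rho t)^-1))); last exact/funext.
have rho0 : rho 0 = r by rewrite /rho expr0n addr0 sqrtr_sqr ger0_norm ?ltW.
rewrite derive1E; apply: derive_val.
(* At $t = 0$ the term with $g''$ vanishes; only the derivative $1/r$ of $t/\rho(t)$ contributes. *)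
have dg1rho : is_derive (0 : R) 1 (derive1 g \o rho) ('D_1 (derive1 g) (rho 0) * (0 / rho 0)).
  by apply: is_derive1_comp; exact: derivableP.
have rho0n : rho 0 != 0 by rewrite gt_eqF.
have dq := is_deriveM_fun (is_derive_id (0 : R) 1) (is_deriveV rho0n (drho 0)).
apply: (is_derive_eq (is_deriveM_fun dg1rho dq)).
by rewrite /= rho0 /GRing.scale /=; field; rewrite gt_eqF.
Qed.
End Reduction.

(** * From a solution in the plane to its profile: radial equation and flux limit *)

Section Profile.
Context {R : realType} (beta n : R) (V psi : R * R -> R).
Implicit Types r s : R.
Context (beta_gt0 : 0 < beta) (n_ge0 : 0 <= n).
Context (V_cont : classC 0 [set: R * R] V) (V_ge0 : forall p, 0 <= V p)
  (V_dec : radially_decreasing V).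
Context (psi_rad : radially_symmetric psi) (psi_C2 : classC 2 [set: R * R] psi)
  (psi_sol : liouville_solution beta n V psi).

Let B := 4 * pi * beta.
Let B_gt0 : 0 < B. Proof. by rewrite !mulr_gt0// pi_gt0. Qed.
Let g := profile psi.

(** On the positive axis $(r g')' = r g'' + g' = r \Delta\psi$. *)
Lemma profile_radial_solution : radial_solution B n (profile V) g.
Proof.
have [psi0 [der [cont1 [der1 _ _]] _]] := psi_C2.
have dg (s : R) : derivable g s 1.
  by rewrite -(derivable_e1E psi s 0); exact: (der (s, 0) I).1.
have g1E : derive1 g = profile ('D_(e1 R) psi) := derive1_profile psi.
split; first exact: dg.
  by rewrite g1E; apply: profile_continuous => p; exact: cont1.
move=> r r0; have rn0 : r != 0 by rewrite gt_eqF.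
have dg1 : derivable (derive1 g) r 1.
  by rewrite g1E -(derivable_e1E ('D_(e1 R) psi) r 0); exact: (der1 (r, 0) I).1.
have dflux := is_deriveM_fun (is_derive_id r 1) (derivableP dg1).
apply: (is_derive_eq dflux).
have := psi_sol.1 (r, 0); rewrite (laplacian_radial psi_rad psi_C2 r0) -/g /density.
rewrite (enorm_axis (ltW r0)) => eqn.
rewrite [X in r * X](_ : _ = derive1 (derive1 g) r); last by rewrite [RHS]derive1E.
rewrite (powRD1 n r0).
have -> : derive1 (derive1 g) r =
    - (B * (r `^ n * V (r, 0) * expR (psi (r, 0)))) - derive1 g r / r.
  by rewrite -eqn; ring.
by rewrite /profile -/(profile psi) -/g /=; field.
Qed.

(** [- B^-1 * flux g] is the primitive of $r F(r)$ vanishing at 0, for [F] the radial density, so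
    total mass 1 fixes its limit. Since [disc_area] is $\pi$, the flux tends to $-2\beta$. *)
Lemma flux_profile_limit :
  flux g r @[r --> +oo] --> - (B / (2 * @disc_area R)).
Proof.
have sg := profile_radial_solution; have [_ _ dflux] := sg.
pose F r := r `^ n * profile V r * expR (g r).
have gc := solution_continuous sg.
have Vc : continuous (profile V) by apply: profile_continuous => p; exact: V_cont.1 p I.
have FE p : F (enorm p) = density n V psi p.
  rewrite /F /density (profile_enorm p V_dec.1) (profile_enorm p psi_rad) //.
have F_ge0 r : 0 <= r -> 0 <= F r.
  by move=> _; rewrite !mulr_ge0 ?powR_ge0 ?expR_ge0// V_ge0.
have F_meas : measurable_fun setT (F : measurableTypeR R -> measurableTypeR R).
  apply: measurable_funM; first apply: measurable_funM.
  - exact: measurable_powR.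
  - exact: continuous_measurable_fun.
  - apply: continuous_measurable_fun => x.
    by apply: (@continuous_comp _ _ _ g expR); [exact: gc|exact: continuous_expR].
have F_total : (\int[lebesgue_measure \x lebesgue_measure]_p (F (enorm p))%:E = 1)%E.
  by rewrite -psi_sol.2; apply: eq_integral => p _; rewrite FE.
(* On $[0,1]$ one has $r^n \le 1$ as $n \ge 0$, while [V] and $e^g$ are largest at 0. *)
have FM r : 0 <= r <= 1 -> F r <= profile V 0 * expR (g 0).
  move=> /andP[r0 r1].
  rewrite ler_pM ?expR_ge0 ?mulr_ge0 ?powR_ge0 ?V_ge0//; last first.
    by rewrite ler_expR (solution_le0 B_gt0 _ sg)// => s _; exact: V_ge0.
  rewrite -[leRHS]mul1r ler_pM ?powR_ge0 ?V_ge0//; last exact: V_dec.2.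
  by have := @ge0_ler_powR R n n_ge0 r 1; rewrite powR1 !nnegrE; apply.
have Fc r : 0 < r -> {for r, continuous F}.
  move=> r0; apply: continuousM; first apply: continuousM.
  - exact: is_derive_continuous (is_derive1_powR n r0).
  - exact: Vc.
  - by apply: (@continuous_comp _ _ _ g expR); [exact: gc|exact: continuous_expR].
pose P r := - B^-1 * flux g r.
have Pc : continuous P.
  by move=> r; apply: cvg_cstM; exact: flux_continuous sg r.
have P0 : P 0 = 0 by rewrite /P flux0 mulr0.
have dP r : 0 < r -> is_derive r 1 P (r * F r).
  move=> r0; apply: (is_derive_eq (is_deriveZ_fun (- B^-1) (dflux r r0))).
  by rewrite (powRD1 n r0) /F; field; rewrite gt_eqF.
have PE := radial_mass F_ge0 F_meas F_total FM Fc Pc P0 dP.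
have -> : flux g = fun r => - B * P r.
  by apply/funext => r; rewrite /P mulrA mulrNN mulfV ?mul1r// gt_eqF.
have -> : - (B / (2 * @disc_area R)) = - B * (2 * @disc_area R)^-1 by rewrite mulNr.
by apply: cvg_cstM; exact: PE.
Qed.

End Profile.

(** * Passage from the hypotheses in the plane to profiles and back *)

Theorem theorem1p4 (R : realType) (beta n : R) (V : R * R -> R)
  (beta_gt0 : 0 < beta) (n_ge0 : 0 <= n)
  (V_C0 : classC 0 [set: R * R] V)
  (V_C1 : classC 1 (~` [set 0]) V)
  (V_ge0 : forall p, 0 <= V p)
  (V_dec : radially_decreasing V)
  (rdV_cont : {within `[0, +oo[, continuous (rdprofile V)})
  (V_decay : exists2 delta : R, 0 < delta &
    (ereal_sup [set (r `^ (n + 2 + delta) * profile V r)%:E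
               | r in `[0%R, +oo[] < +oo)%E)
  (V_sign : forall c : R, 0 < c -> c < n + 2 ->
    exists2 rc : R, 0 < rc &
      (forall r, 0 <= r -> r <= rc -> 0 <= c * profile V r + rdprofile V r) /\
      (forall r, rc <= r -> c * profile V r + rdprofile V r <= 0)) :
  is_subset1 [set psi : R * R -> R |
    [/\ radially_symmetric psi, classC 2 [set: R * R] psi
      & liouville_solution beta n V psi]].
Proof.
move=> psi1 psi2 [rad1 C1 sol1] [rad2 C2 sol2].
have B0 : 0 < 4 * pi * beta by rewrite !mulr_gt0// pi_gt0.
have Vd (r : R) : 0 < r -> derivable (profile V) r 1.
  move=> r0; rewrite -(derivable_e1E V r 0); have [_ [der _ _]] := V_C1.
  by apply: (der (r, 0) _).1 => -[r0']; move: r0; rewrite r0' ltxx.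
have Vdec : exists2 delta : R, 0 < delta & exists M : R, forall r : R,
    0 <= r -> r `^ (n + 2 + delta) * profile V r <= M.
  have [delta delta0 supV] := V_decay; exists delta => //.
  set S := [set _ | _ in _] in supV.
  have memS r : 0 <= r -> S (r `^ (n + 2 + delta) * profile V r)%:E.
    by move=> r0; exists r => //=; rewrite in_itv /= r0.
  (* The supremum is real: below [+oo] by hypothesis and above [-oo] since it dominates a real
     value. *)
  exists (fine (ereal_sup S)) => r r0.
  have ub := ereal_sup_ubound (memS r r0).
  rewrite -lee_fin fineK// fin_real// supV andbT.
  by rewrite (lt_le_trans _ ub)// ltNyr.
have m0 : - (4 * pi * beta / (2 * @disc_area R)) != 0.
  by rewrite oppr_eq0 gt_eqF// divr_gt0// mulr_gt0// disc_area_gt0.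
have g12 := radial_solution_unique B0 n_ge0 (fun r _ => V_ge0 (r, 0)) V_dec.2 Vd Vdec
  V_sign (profile_radial_solution rad1 C1 sol1) (profile_radial_solution rad2 C2 sol2)
  (flux_profile_limit beta_gt0 n_ge0 V_C0 V_ge0 V_dec rad1 C1 sol1)
  (flux_profile_limit beta_gt0 n_ge0 V_C0 V_ge0 V_dec rad2 C2 sol2) m0.
apply/funext => p; rewrite (profile_enorm p rad1) (profile_enorm p rad2).
by apply: g12; exact: enorm_ge0.
Qed.
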